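(* There exist constants $C^\star$ and $\alpha^\star$, where $\alpha^\star$ depends on $\mathbf{P}^\star$, such that any penalty $\mathrm{pen}(n,r)$ and cutoff $\kappa(n)$ that satisfy, eventually as $n\to\infty$, $$\mathrm{pen}(n,r)=|\mathsf{A}|^r f(n)\log\log n,\qquad \kappa(n)\le\alpha^\star\log n,$$ where $\kappa(n)\nearrow\infty$ and the function $f(n)$ satisfies $$\liminf_{n\to\infty}f(n)\ge C^\star,\qquad \lim_{n\to\infty}\frac{f(n)\log\log n}{n}=0,$$ yield a strongly consistent Markov order estimator; that is, the estimator $$\hat r_n=\mathop{\mathrm{argmax}}_{0\le r<\kappa(n)}\left\{\sup_{\mathbf{P}\in\Theta^r}\log\mathbf{P}(x_{1:n})-\mathrm{pen}(n,r)\right\}$$ satisfies $\hat r_n\to r^\star$ as $n\to\infty$, $\mathbf{P}^\star$-a.s.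
   Context: Fix once and for all an alphabet $\mathsf{A}$ of finite cardinality $|\mathsf{A}|<\infty$. Let $\Omega=\mathsf{A}^{\mathbb{N}}$ with its Borel $\sigma$-field and coordinate process $(X_k)_{k\ge1}$. Write $x_{m:n}=(x_m,\ldots,x_n)\in\mathsf{A}^{n-m+1}$, and, for a probability measure $\mathbf{P}$ on $\Omega$, write $\mathbf{P}(x_{m:n})$ and $\mathbf{P}(x_{m:n}|x_{r:s})$ for $\mathbf{P}(X_{m:n}=x_{m:n})$ and $\mathbf{P}(X_{m:n}=x_{m:n}|X_{r:s}=x_{r:s})$. In random expressions $x_{1:n}$ is the observed path $X_{1:n}$. The variable $r$ ranges over nonnegative integers. For $r\ge0$, $\Theta^r$ is the set of all probability measures $\mathbf{P}$ on $\Omega$ that are time-homogeneous Markov chains of order at most $r$: $\mathbf{P}(x_{1:n})=\mathbf{P}(x_{1:r})\prod_{i=r+1}^n\mathbf{P}(x_i|x_{i-r:i-1})$ for all $n\ge r$ and $x_{1:n}\in\mathsf{A}^n$, and $\mathbf{P}(X_i=x_{r+1}|X_{i-r:i-1}=x_{1:r})=\mathbf{P}(x_{r+1}|x_{1:r})$ for all $i>r$ and $x_{1:r+1}\in\mathsf{A}^{r+1}$ (so $\mathbf{P}$ is determined by its initial law on $\mathsf{A}^r$ and its transition probabilities from $\mathsf{A}^r$ to $\mathsf{A}$; $\Theta^0$ is the class of all i.i.d. processes). The order of a Markov chain $\mathbf{P}$ is the smallest $r\ge0$ with $\mathbf{P}\in\Theta^r$. Throughout, $\mathbf{P}^\star$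 is a fixed Markov chain of order $r^\star$, the true law of the observed process, and it is assumed to be stationary and irreducible (any $r^\star$-block of positive probability can be reached with positive probability from any other such block). $\kappa(n)\nearrow\infty$ means that $\kappa$ is increasing and tends to infinity. *)

(* Defs.v *)
From HB Require Import structures.
From mathcomp Require Import all_boot all_order all_algebra.
From mathcomp Require Import all_classical all_reals all_analysis.

Set Implicit Arguments.
Unset Strict Implicit.
Unset Printing Implicit Defensive.

Import Order.TTheory GRing.Theory Num.Theory.

Local Open Scope classical_set_scope.
Local Open Scope ring_scope.

(* Product topology on infinite words over the discrete alphabet A.  MathComp's
   measurable types are pointed; the letter a0 serves only to provide a point,
   i.e. it witnesses that the alphabet is nonempty. *)
Definition word_space (A : finType) (a0 : A) : Type :=
  prod_topology (fun _ : nat => discrete_topology A).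

HB.instance Definition _ (A : finType) (a0 : A) :=
  Topological.on (word_space a0).

HB.instance Definition _ (A : finType) (a0 : A) :=
  isPointed.Build (word_space a0) (fun=> a0).

(* A ^ nat with its Borel sigma-field.  Indices are shifted by one: for
   w : Omega a0, the letter w k is the coordinate X_(k+1). *)
Definition Omega (A : finType) (a0 : A) :=
  g_sigma_algebraType (@open (word_space a0)).

(* The word (x_(m+1), ..., x_n); it is empty when n <= m. *)
Definition block (A : finType) (a0 : A) (x : Omega a0) (m n : nat) : seq A :=
  [seq x i | i <- index_iota m n].

(* The event {X_(m+1 : n) = s}. *)
Definition block_event (A : finType) (a0 : A) (m n : nat) (s : seq A)
    : set (Omega a0) :=
  [set w | block w m n = s].
Arguments block_event {A} a0 m n s.

Definition shift (A : finType) (a0 : A) (w : Omega a0) : Omega a0 :=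
  fun k => w k.+1.

(* Takes the junk value 0 when F is a null event. *)
Definition cond_prob d (T : measurableType d) (R : realType)
    (P : probability T R) (E F : set T) : R :=
  fine (P (E `&` F)) / fine (P F).

(* Time-homogeneous Markov chains of order at most r.  The common transition
   probabilities q s a from A^r to A are constrained only by conditional
   probabilities that are defined: a block s may be null at one time and have
   positive probability at another.  In the factorization, a factor given a
   null block is preceded by a partial product that already vanishes. *)
Definition Theta (R : realType) (A : finType) (a0 : A) (r : nat)
    : set (probability (Omega a0) R) :=
  [set P : probability (Omega a0) R |
    (forall (n : nat) (x : Omega a0), (r <= n)%N ->
       fine (P (block_event a0 0 n (block x 0 n))) =
       fine (P (block_event a0 0 r (block x 0 r))) *
       \prod_(r <= i < n)
          cond_prob P (block_event a0 i i.+1 [:: x i])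
                      (block_event a0 (i - r) i (block x (i - r) i)))
    /\
    (exists q : seq A -> A -> R,
       forall (i : nat) (s : seq A) (a : A), (r <= i)%N -> size s = r ->
         (0 < P (block_event a0 (i - r) i s))%E ->
         cond_prob P (block_event a0 i i.+1 [:: a])
                     (block_event a0 (i - r) i s) = q s a)].
Arguments Theta R {A} a0 r.

Definition markov_order (R : realType) (A : finType) (a0 : A)
    (P : probability (Omega a0) R) (r : nat) : Prop :=
  Theta R a0 r P /\ forall s : nat, Theta R a0 s P -> (r <= s)%N.

Definition stationary (R : realType) (A : finType) (a0 : A)
    (P : probability (Omega a0) R) : Prop :=
  forall B : set (Omega a0), measurable B ->
    P (@shift A a0 @^-1` B) = P B.

(* Positive probability of an r-block is tested at time 1, which loses nothing
   for the stationary P this is applied to. *)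
Definition irreducible (R : realType) (A : finType) (a0 : A)
    (P : probability (Omega a0) R) (r : nat) : Prop :=
  forall s t : seq A, size s = r -> size t = r -> s <> t ->
    (0 < P (block_event a0 0 r s))%E ->
    (0 < P (block_event a0 0 r t))%E ->
    exists k : nat,
      0 < cond_prob P (block_event a0 k (k + r) t) (block_event a0 0 r s).

(* Extended-real valued, as log 0 = -oo for P not charging the observation. *)
Definition max_log_likelihood (R : realType) (A : finType) (a0 : A)
    (x : Omega a0) (n r : nat) : \bar R :=
  ereal_sup [set lne (P (block_event a0 0 n (block x 0 n)))
            | P in Theta R a0 r].
Arguments max_log_likelihood R {A a0} x n r.

Definition penalized (R : realType) (A : finType) (a0 : A)
    (pen : nat -> nat -> R) (x : Omega a0) (n r : nat) : \bar R :=
  (max_log_likelihood R x n r - (pen n r)%:E)%E.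

Definition order_argmax (R : realType) (A : finType) (a0 : A)
    (pen : nat -> nat -> R) (kappa : nat -> R) (x : Omega a0) (n : nat)
    : set nat :=
  [set r | r%:R < kappa n /\
     forall s : nat, s%:R < kappa n ->
       (penalized pen x n s <= penalized pen x n r)%E].

(* Nothing is required while {0 <= r < kappa n} is empty.  Ties are broken
   arbitrarily, except over a one-letter alphabet: there all orders always tie,
   and the argmax is read as the least maximizer. *)
Definition order_estimator (R : realType) (A : finType) (a0 : A)
    (pen : nat -> nat -> R) (kappa : nat -> R)
    (rhat : nat -> Omega a0 -> nat) : Prop :=
  forall (n : nat) (x : Omega a0), 0 < kappa n ->
    order_argmax pen kappa x n (rhat n x) /\
    (#|A| = 1%N ->
       forall s : nat, order_argmax pen kappa x n s -> (rhat n x <= s)%N).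

(* Main.v *)
(** A Markov chain of order r predicts the next letter from its context, the
    last r letters.  Let M(s, a) be the number of transitions from the context
    s to the letter a, minus its conditional mean N(s) p(a|s), where N(s)
    counts the visits to s.  The gain in log-likelihood over P* from fitting
    an order r >= r* is at most the initial term - log P*(x_1:r) plus the sum
    of M(s, a)^2 / (N(s) p(a|s)).

    This sum is bounded for all r and n at once by betting against P*.  To each
    context is attached a stake mu, 0 or a signed dyadic number, and the
    product over time of the factors 1 + mu (1[X_i = a] - p(a|s_i)) is a
    martingale.  Averaging over all stakes of size at least 2^-(L+1), and
    summing over r, a and L with summable weights, gives one supermartingale,
    so almost surely each bet is bounded by a constant (depending on the path)
    times the reciprocal of its weight.  With 2^L of order n there are about
    (log n)^(|A|^r) choices of stakes, whence a bound of order
    |A|^r log log n for the stakes that are optimal in hindsight.  Contexts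
    with M > 2 N p would cost a factor 1 / p; for them L = 1 suffices, which
    costs only O(|A|^r).

    For r < r* the same bound with r = r* gives M(s, a) = o(n).  Visits are
    then nearly conserved along possible transitions, so irreducibility makes
    every charged context of length r* be visited linearly often.  As two of
    them have the same last r letters and different transition probabilities,
    order r loses a linear amount of log-likelihood.  *)

Require Import Defs.
From HB Require Import structures.
From mathcomp Require Import all_boot all_order all_algebra.
From mathcomp Require Import all_classical all_reals all_analysis.
From mathcomp Require Import ring lra zify.

Set Implicit Arguments.
Unset Strict Implicit.
Unset Printing Implicit Defensive.

Import Order.TTheory GRing.Theory Num.Theory.
Import numFieldNormedType.Exports.

Local Open Scope classical_set_scope.
Local Open Scope ring_scope.

(** * Words and the maximal inequality *)

Section Blocks.
Variables (A : finType) (a0 : A).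
Implicit Type x : Omega a0.

Lemma block_nil x m n : (n <= m)%N -> block x m n = [::].
Proof. by rewrite /block /index_iota -subn_eq0 => /eqP ->. Qed.

Lemma block_cons x m n : (m < n)%N -> block x m n = x m :: block x m.+1 n.
Proof. by move=> mn; rewrite /block /index_iota -(subnSK mn). Qed.

Lemma block_rcons x m n : (m <= n)%N -> block x m n.+1 = rcons (block x m n) (x n).
Proof.
by move=> mn; rewrite /block /index_iota subSn// -addn1 iotaD map_cat/= subnKC// cats1.
Qed.

Lemma size_block x m n : size (block x m n) = (n - m)%N.
Proof. by rewrite size_map size_iota. Qed.

Lemma block_cat x m k n : (m <= k <= n)%N -> block x m n = block x m k ++ block x k n.
Proof.
move=> /andP[mk kn]; rewrite /block /index_iota -map_cat.
by rewrite -{2}(subnKC mk) -iotaD; congr (map _ (iota _ _)); lia.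
Qed.

Lemma measurable_letter k a : measurable [set x : Omega a0 | x k = a].
Proof.
apply: sub_sigma_algebra => /=.
have -> : [set x : Omega a0 | x k = a] =
  (fun x : word_space a0 => x k) @^-1` [set a : discrete_topology A] by [].
apply: open_comp; last exact: discrete_open.
move=> x _; exact: (@proj_continuous _ (fun=> discrete_topology A)).
Qed.

Lemma measurable_block_event m n s : measurable (block_event a0 m n s).
Proof.
elim: s m => [|a s IH] m.
  rewrite /block_event; have [nm|mn] := leqP n m.
    rewrite (_ : [set _ | _] = setT)//.
    by apply/seteqP; split=> // x _ /=; rewrite block_nil.
  rewrite (_ : [set _ | _] = set0)//.
  by apply/seteqP; split=> // x /=; rewrite block_cons.
have [nm|mn] := leqP n m.
  rewrite (_ : block_event _ _ _ _ = set0)//.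
  by apply/seteqP; split=> // x /=; rewrite /block_event/= block_nil.
rewrite (_ : block_event _ _ _ _ =
  [set x | x m = a] `&` block_event a0 m.+1 n s); last first.
  apply/seteqP; split=> x /=; rewrite /block_event /= (block_cons x mn).
    by move=> [].
  by move=> [-> ->].
by apply: measurableI; [exact: measurable_letter|exact: IH].
Qed.

(** Words are countable, so the event is a countable union of block events. *)
Lemma measurable_prefix n (D : set (seq A)) :
  measurable [set x : Omega a0 | D (block x 0 n)].
Proof.
have -> : [set x : Omega a0 | D (block x 0 n)] =
    \bigcup_(k in [set k | exists2 s, unpickle k = Some s & D s])
      block_event a0 0 n (odflt [::] (unpickle k)).
  apply/seteqP; split=> [x Dx|x [k [s ks Ds]]].
    exists (pickle (block x 0 n)); first by exists (block x 0 n); rewrite ?pickleK.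
    by rewrite pickleK.
  by rewrite ks /block_event /mkset => ->.
by apply: bigcup_measurable => k _; exact: measurable_block_event.
Qed.

Lemma take_block x n N : (n <= N)%N -> take n (block x 0 N) = block x 0 n.
Proof.
move=> nN; rewrite (@block_cat x 0 n N)// take_size_cat// size_block; lia.
Qed.

Lemma block_event_rcons m n s b : (m <= n)%N ->
  block_event a0 m n.+1 (rcons s b) = block_event a0 m n s `&` [set x | x n = b].
Proof.
move=> mn; apply/seteqP; split=> x; rewrite /block_event /= block_rcons//.
  by move=> /rcons_inj[-> ->].
by move=> [-> ->].
Qed.

Lemma block_event_cons m n s b : (m < n)%N ->
  block_event a0 m n (b :: s) = block_event a0 m.+1 n s `&` [set x | x m = b].
Proof.
move=> mn; apply/seteqP; split=> x; rewrite /block_event /= (block_cons x mn).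
  by move=> [-> ->].
by move=> [-> ->].
Qed.

End Blocks.

Section WordProb.
Variables (R : realType) (A : finType) (a0 : A) (P : probability (Omega a0) R).

Lemma prob_fine_le (E F : set (Omega a0)) : measurable E -> measurable F -> E `<=` F ->
  fine (P E) <= fine (P F).
Proof.
by move=> mE mF EF; rewrite fine_le ?fin_num_measure// le_measure// inE.
Qed.

Lemma fine_ge0_prob (E : set (Omega a0)) : 0 <= fine (P E).
Proof. exact: fine_ge0. Qed.

Lemma total_prob k (E : set (Omega a0)) : measurable E ->
  fine (P E) = \sum_(a : A) fine (P (E `&` [set x | x k = a])).
Proof.
move=> mE.
have mEa a : measurable (E `&` [set x | x k = a]).
  by apply: measurableI => //; exact: measurable_letter.
have {1}-> : E = \bigcup_(a in [set: A]) (E `&` [set x | x k = a]).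
  by apply/seteqP; split=> [x Ex|x [a _ []]//]; exists (x k).
rewrite measure_fin_bigcup//; first last.
- by move=> a b _ _ [x [[_ /= <-] [_ /= <-]]].
- exact: finite_finset.
rewrite (_ : [set: A] = [set` index_enum A]); last first.
  by apply/seteqP; split=> // a _; rewrite /= mem_index_enum.
rewrite -fsbig_seq ?index_enum_uniq//= sum_fine// => a _.
by rewrite fin_num_measure.
Qed.
Definition wprob (w : seq A) : R := fine (P (block_event a0 0 (size w) w)).

Lemma wprob_ge0 w : 0 <= wprob w.
Proof. exact: fine_ge0_prob. Qed.

Lemma wprob_nil : wprob [::] = 1.
Proof.
rewrite /wprob (_ : block_event _ _ _ _ = setT) ?probability_setT//.
by apply/seteqP; split=> // x _; rewrite /block_event /= block_nil.
Qed.

Lemma sum_wprob_rcons w : \sum_b wprob (rcons w b) = wprob w.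
Proof.
rewrite {2}/wprob (total_prob (size w)); last exact: measurable_block_event.
by apply: eq_bigr => b _; rewrite /wprob size_rcons block_event_rcons.
Qed.

(** An adapted process is a function of the observed prefix. The conditional inequality is
    multiplied by the probability of w, which avoids conditioning on null words. *)
Definition supermartingale (V : seq A -> R) :=
  (forall w, 0 <= V w) /\
  (forall w, \sum_b wprob (rcons w b) * V (rcons w b) <= wprob w * V w).

(* Ville's maximal inequality; k is the remaining time. *)
Lemma ville (V : seq A -> R) (c : R) (k : nat) (w : seq A) :
  supermartingale V -> 0 < c ->
  fine (P [set x : Omega a0 | block x 0 (size w) = w /\
    exists2 n, (size w <= n <= size w + k)%N & c <= V (block x 0 n)])
    <= wprob w * V w / c.
Proof.
move=> [V0 Vs] c0.
have mE j u : measurable [set x : Omega a0 | block x 0 (size u) = u /\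
    exists2 n, (size u <= n <= size u + j)%N & c <= V (block x 0 n)].
  pose D := [set v : seq A | take (size u) v = u /\
    exists2 n, (size u <= n <= size u + j)%N & c <= V (take n v)].
  have := @measurable_prefix A a0 (size u + j) D; congr (measurable _).
  apply/seteqP; split=> x; rewrite /D /= take_block ?leq_addr//; move=> [-> [n nu cV]];
    by split=> //; exists n => //; move: cV; rewrite take_block//; case/andP: nu.
elim: k w => [|k IH] w; have [cV|Vc] := leP c (V w).
- apply: (@le_trans _ _ (wprob w)).
    by apply: prob_fine_le => //; [exact: measurable_block_event|move=> x []].
  by rewrite -mulrA ler_peMr ?wprob_ge0// ler_pdivlMr// mul1r.
- rewrite (_ : [set _ | _] = set0) ?measure0 ?divr_ge0 ?mulr_ge0 ?wprob_ge0 ?(ltW c0)//.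
  apply/seteqP; split=> // x [/= xw [n]]; rewrite addn0 -eqn_leq => /eqP <-.
  by rewrite xw leNgt Vc.
- apply: (@le_trans _ _ (wprob w)).
    by apply: prob_fine_le => //; [exact: measurable_block_event|move=> x []].
  by rewrite -mulrA ler_peMr ?wprob_ge0// ler_pdivlMr// mul1r.
(* As [V w < c], the level is reached strictly later. The event splits by the next letter into
   events with one step less, whose bounds are summed by the supermartingale property. *)
- rewrite (total_prob (size w)) //.
  apply: (@le_trans _ _ (\sum_b wprob (rcons w b) * V (rcons w b) / c)); last first.
    by rewrite -mulr_suml ler_pM2r ?invr_gt0//.
  apply: ler_sum => b _; apply: le_trans (IH (rcons w b)).
  apply: prob_fine_le; [by apply: measurableI => //; exact: measurable_letter|exact: mE|].
  move=> x /= [[xw [n /andP[wn nk] cV]] xb].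
  rewrite size_rcons block_rcons//= xw xb; split=> //; exists n => //.
  rewrite addSnnS nk andbT ltn_neqAle wn andbT; apply/eqP => e.
  by move: cV; rewrite -e xw leNgt Vc.
Qed.

(** A substitute for an infinite mixture: the finite mixtures increase with J, so Ville's bound
    passes to the union over J. The level k + 1 is exceeded with probability at most C / (k + 1),
    and the intersection over k is null. *)
Lemma supermartingales_bounded (V : nat -> seq A -> R) (C : R) :
  (forall J, supermartingale (V J)) -> (forall J w, V J w <= V J.+1 w) ->
  (forall J, V J [::] <= C) ->
  {ae P, forall x : Omega a0, exists2 K, 0 < K & forall J n, V J (block x 0 n) <= K}.
Proof.
move=> Vs Vmono VC.
have Vle J1 J2 w : (J1 <= J2)%N -> V J1 w <= V J2 w.
  by move=> /subnK <-; elim: (J2 - J1)%N => // j /le_trans; apply; rewrite addSn.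
(* One index J limits both the mixture and the time horizon, which makes these events increase with
   J. *)
pose E k J := [set x : Omega a0 | exists2 n, (n <= J)%N & k.+1%:R <= V J (block x 0 n)].
have mE k J : measurable (E k J).
  pose D := [set v : seq A | exists2 n, (n <= J)%N & k.+1%:R <= V J (take n v)].
  have := @measurable_prefix A a0 J D; congr (measurable _).
  by apply/seteqP; split=> x [n nJ h]; exists n => //; move: h; rewrite take_block.
have mB k : measurable (\bigcup_J E k J) by exact: bigcup_measurable.
have PB k : fine (P (\bigcup_J E k J)) * k.+1%:R <= C.
  rewrite -ler_pdivlMr// -lee_fin fineK ?fin_num_measure//.
  have nd : nondecreasing_seq (E k).
    move=> J1 J2 J12; apply/subsetPset => x [n nJ h].
    by exists n; [exact: leq_trans J12|exact: le_trans (Vle _ _ _ J12)].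
  have cv := @nondecreasing_cvg_mu _ _ _ P _ (mE k) (mB k) nd.
  rewrite -(cvg_lim _ cv)//; apply: lime_le; first by apply/cvg_ex; eexists; exact: cv.
  apply: nearW => J /=; rewrite -(fineK (fin_num_measure P _ (mE k J))) lee_fin.
  have := @ville (V J) k.+1%:R J [::] (Vs J) (ltr0Sn _ _).
  rewrite wprob_nil mul1r => h.
  have {h} : fine (P (E k J)) <= V J [::] / k.+1%:R.
    apply: le_trans h; rewrite le_eqVlt; apply/orP; left; apply/eqP; congr (fine (P _)).
    apply/seteqP; split=> x /=.
      by move=> [n nJ h]; split; [rewrite block_nil|exists n].
    by move=> [_ [n /= nJ h]]; exists n.
  by move=> /le_trans; apply; rewrite ler_pM2r ?invr_gt0.
exists (\bigcap_k \bigcup_J E k J); split.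
- exact: bigcap_measurable.
- have mN : measurable (\bigcap_k \bigcup_J E k J) by exact: bigcap_measurable.
  rewrite -(fineK (fin_num_measure P _ mN)); congr EFin; apply/eqP.
  rewrite eq_le fine_ge0_prob andbT leNgt; apply/negP => p0.
  set p := fine _ in p0.
  (* For this k, k + 1 exceeds C / p, against the bound p (k + 1) <= C. *)
  have := PB (Num.truncn (C / p)); apply/negP; rewrite -ltNge.
  have /andP[_] := truncn_itv (divr_ge0 (le_trans ((Vs 0%N).1 _) (VC 0%N)) (ltW p0)).
  rewrite ltr_pdivrMr// => /lt_le_trans; apply; rewrite mulrC ler_pM2r//.
  by apply: prob_fine_le => // x; apply.
- move=> x /= nb k _; apply: contrapT => h; apply: nb; exists k.+1%:R => // J n.
  rewrite leNgt; apply/negP => l; apply: h; exists (maxn J n) => //.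
  exists n; first exact: leq_maxr.
  by apply: (le_trans (ltW l)); apply: Vle; exact: leq_maxl.
Qed.

End WordProb.

(** * Betting against the law of a chain *)

Section Bets.
Variables (R : realType) (A : finType) (a0 : A) (P : probability (Omega a0) R).

Lemma supermartingale_sum (I : Type) (s : seq I) (V : I -> seq A -> R) :
  (forall i, supermartingale P (V i)) ->
  supermartingale P (fun w => \sum_(i <- s) V i w).
Proof.
move=> VP; split=> w; first by apply: sumr_ge0 => i _; exact: (VP i).1.
under eq_bigr do rewrite mulr_sumr.
by rewrite exchange_big mulr_sumr; apply: ler_sum => i _; exact: (VP i).2.
Qed.

Lemma supermartingaleZ (c : R) (V : seq A -> R) : 0 <= c ->
  supermartingale P V -> supermartingale P (fun w => c * V w).
Proof.
move=> c0 [V0 Vs]; split=> w; first by rewrite mulr_ge0.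
under eq_bigr do rewrite mulrCA.
by rewrite -mulr_sumr mulrCA ler_wpM2l.
Qed.

(** The capital of a gambler that is multiplied by [g u b] when the letter b follows the past u. *)
Definition pathprod (g : seq A -> A -> R) (w : seq A) : R :=
  \prod_(i < size w) g (take i w) (nth a0 w i).

Lemma pathprod_rcons g w b : pathprod g (rcons w b) = pathprod g w * g w b.
Proof.
rewrite /pathprod -!(big_mkord xpredT (fun i => g (take i _) (nth a0 _ i))).
rewrite size_rcons big_nat_recr//=; congr (_ * _).
  apply: eq_big_nat => i /andP[_ iw].
  by rewrite -cats1 takel_cat ?(ltnW iw)// nth_cat iw.
by rewrite -cats1 take_size_cat// nth_cat ltnn subnn.
Qed.

Lemma pathprod_block g (x : Omega a0) n :
  pathprod g (block x 0 n) = \prod_(0 <= i < n) g (block x 0 i) (x i).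
Proof.
elim: n => [|n IH]; first by rewrite block_nil// /pathprod big_ord0 big_nil.
by rewrite block_rcons// pathprod_rcons IH big_nat_recr.
Qed.

Lemma pathprod_supermartingale g : (forall u b, 0 <= g u b) ->
  (forall u, \sum_b wprob P (rcons u b) * g u b <= wprob P u) ->
  supermartingale P (pathprod g).
Proof.
move=> g0 gs; split=> w; first by apply: prodr_ge0.
under eq_bigr do rewrite pathprod_rcons mulrCA mulrC.
by rewrite -mulr_suml ler_wpM2r// prodr_ge0.
Qed.

(** On words shorter than r the truncated subtraction returns the whole word. *)
Definition suffix_of (r : nat) (w : seq A) : seq A := drop (size w - r) w.

Lemma suffix_of_block (x : Omega a0) r m n : (m + r <= n)%N ->
  suffix_of r (block x m n) = block x (n - r) n.
Proof.
move=> mrn; rewrite /suffix_of (@block_cat _ _ x m (n - r) n); last by lia.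
by rewrite drop_size_cat// size_cat !size_block; lia.
Qed.

(** A sign and a dyadic exponent for each context of length r. The type is finite, so strategies can
    be averaged uniformly. *)
Definition wagers (r L : nat) := {ffun r.-tuple A -> bool * 'I_L.+1}.

(* Index 0 means no bet; index j > 0 is a bet of size 2^-(j+1). *)
Definition stake (L : nat) (e : bool * 'I_L.+1) : R :=
  if e.2 == ord0 then 0 else (-1) ^+ e.1 * 2^-1 ^+ e.2.+1.

Lemma norm_stake L (e : bool * 'I_L.+1) : `|stake e| <= 4^-1.
Proof.
rewrite /stake; case: ifPn => [_|]; first by rewrite normr0 invr_ge0.
case: e => e [[|j] jL]//= _.
rewrite normrM normrX normrN1 expr1n mul1r normrX ger0_norm ?invr_ge0//.
rewrite !exprS mulrA -invfM -natrM ler_piMr ?invr_ge0//.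
by rewrite exprn_ile1 ?invr_ge0// invf_le1// ler1n.
Qed.

Definition stake_of r L (phi : wagers r L) (s : seq A) : R :=
  if insub s is Some t then stake (phi t) else 0.

Lemma norm_stake_of r L (phi : wagers r L) s : `|stake_of phi s| <= 4^-1.
Proof.
rewrite /stake_of; case: insub => [t|]; first exact: norm_stake.
by rewrite normr0 invr_ge0.
Qed.

Lemma stake_of_tuple r L (phi : wagers r L) (t : r.-tuple A) :
  stake_of phi t = stake (phi t).
Proof. by rewrite /stake_of valK. Qed.

Variables (rs : nat) (q : seq A -> A -> R).
Hypothesis q01 : forall s a, 0 <= q s a <= 1.
Hypothesis wprob_q : forall w a, (rs <= size w)%N ->
  wprob P (rcons w a) = wprob P w * q (suffix_of rs w) a.

(** The stake is read from the last r letters, the fair price from the last [rs]. No bet is placed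
    before both contexts are complete. *)
Definition bet r (a : A) (mu : seq A -> R) (u : seq A) (b : A) : R :=
  if (size u < maxn r rs)%N then 1
  else 1 + mu (suffix_of r u) * ((b == a)%:R - q (suffix_of rs u) a).

(** The indicator of a has conditional mean q, so each bet is fair; stakes of at most 1/4 keep the
    factors nonnegative. *)
Lemma bet_supermartingale r a mu : (forall s, `|mu s| <= 4^-1) ->
  supermartingale P (pathprod (bet r a mu)).
Proof.
move=> mu2; apply: pathprod_supermartingale => [u b|u]; rewrite /bet; case: ltnP => ur.
- exact: ler01.
- set m := mu _; set y := _ - _.
  have y1 : `|y| <= 1.
    rewrite /y; have := q01 (suffix_of rs u) a; case: (b == a) => /=; rewrite ler_norml; lra.
  have : `|m * y| <= 1.
    rewrite normrM; have := mu2 (suffix_of r u); rewrite -/m => ?.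
    by apply: mulr_ile1 => //; lra.
  by rewrite ler_norml; lra.
- by under eq_bigr do rewrite mulr1; rewrite sum_wprob_rcons.
under eq_bigr do rewrite mulrDr mulr1.
rewrite big_split sum_wprob_rcons /=.
under eq_bigr do rewrite mulrCA mulrBr.
rewrite -mulr_sumr sumrB -mulr_suml sum_wprob_rcons.
rewrite (bigD1 a)//= eqxx mulr1 big1 ?addr0; last first.
  by move=> b /negbTE ->; rewrite mulr0.
by rewrite wprob_q ?subrr ?mulr0 ?addr0// (leq_trans (leq_maxr r rs)).
Qed.

(** A telescoping series of total mass 1 whose reciprocals are polynomial, so that paying for k
    costs only a logarithm. *)
Definition weight (k : nat) : R := (k.+1 * k.+2)%:R^-1.

Lemma weight_gt0 k : 0 < weight k.
Proof. by rewrite invr_gt0 ltr0n. Qed.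

Lemma sum_weight J : \sum_(k < J) weight k <= 1.
Proof.
suff -> : \sum_(k < J) weight k = 1 - J.+1%:R^-1.
  by rewrite lerBlDr lerDl invr_ge0.
elim: J => [|J IH]; first by rewrite big_ord0 invr1 subrr.
rewrite big_ord_recr IH /= /weight natrM -[J.+2%:R]natr1 -[J.+1%:R]natr1.
have J0 : 0 <= J%:R :> R by [].
by field; rewrite !natr1 !pnatr_eq0.
Qed.

Definition wager_mixture r a L (w : seq A) : R :=
  (#|{: wagers r L}|%:R)^-1 *
  \sum_(phi : wagers r L) pathprod (bet r a (stake_of phi)) w.

Lemma wager_mixture_supermartingale r a L : supermartingale P (wager_mixture r a L).
Proof.
apply: supermartingaleZ; first by rewrite invr_ge0.
by apply: supermartingale_sum => phi; apply: bet_supermartingale => s; exact: norm_stake_of.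
Qed.

Lemma card_wagers_gt0 r L : (0 < #|{: wagers r L}|)%N.
Proof. by apply/card_gt0P; exists [ffun=> (true, ord0)]. Qed.

Lemma wager_mixture_nil r a L : wager_mixture r a L [::] = 1.
Proof.
rewrite /wager_mixture (eq_bigr (fun=> 1)); last first.
  by move=> phi _; rewrite /pathprod big_ord0.
by rewrite sumr_const mulVf// pnatr_eq0 -lt0n card_wagers_gt0.
Qed.

Lemma card_wagers r L : #|{: wagers r L}| = ((2 * L.+1) ^ (#|A| ^ r))%N.
Proof. by rewrite card_ffun card_prod card_bool card_ord card_tuple. Qed.

(** A single strategy is at most the reciprocal of its weight times the whole mixture. The right
    side is K divided by the weights of r and L, times the number of wagers. *)
Lemma bets_bounded : {ae P, forall x : Omega a0, exists2 K, 0 < K &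
  forall r a L (phi : wagers r L) n,
    pathprod (bet r a (stake_of phi)) (block x 0 n) <=
    K * (r.+1 * r.+2)%:R * (L.+1 * L.+2)%:R * (2 * L.+1)%:R ^+ (#|A| ^ r)}.
Proof.
pose T r a L w := weight r * weight L * wager_mixture r a L w.
have T0 r a L w : 0 <= T r a L w.
  have [wm _] := wager_mixture_supermartingale r a L.
  by apply: mulr_ge0 => //; apply: mulr_ge0; exact: ltW (weight_gt0 _).
pose Z J w := \sum_(r < J) \sum_a \sum_(L < J) T r a L w.
have Zs J : supermartingale P (Z J).
  do 3![apply: supermartingale_sum => ?]; apply: supermartingaleZ.
    by apply: mulr_ge0; exact: ltW (weight_gt0 _).
  exact: wager_mixture_supermartingale.
have Zmono J w : Z J w <= Z J.+1 w.
  rewrite /Z big_ord_recr/=; apply: ler_wpDr.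
    by do 2![apply: sumr_ge0 => ? _].
  apply: ler_sum => r _; apply: ler_sum => a _.
  by rewrite [leRHS]big_ord_recr/= lerDl.
(* Each letter starts with total capital at most 1. *)
have Znil J : Z J [::] <= #|A|%:R.
  rewrite /Z exchange_big/=.
  apply: (@le_trans _ _ (\sum_(a : A) 1)); last by rewrite sumr_const.
  apply: ler_sum => a _.
  under eq_bigr do under eq_bigr do rewrite /T wager_mixture_nil mulr1.
  under eq_bigr do rewrite -mulr_sumr.
  rewrite -mulr_suml mulr_ile1 ?sum_weight// sumr_ge0// => k _; exact: ltW (weight_gt0 _).
apply: filterS (supermartingales_bounded Zs Zmono Znil) => x [K K0 ZK].
exists K => // r a L phi n.
set w := block x 0 n.
have TK : T r a L w <= K.
  apply: le_trans (ZK (maxn r L).+1 n); rewrite -/w /Z.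
  have rJ : (r < (maxn r L).+1)%N by rewrite ltnS leq_maxl.
  have LJ : (L < (maxn r L).+1)%N by rewrite ltnS leq_maxr.
  rewrite (bigD1 (Ordinal rJ))//= (bigD1 a)//= (bigD1 (Ordinal LJ))//= -!addrA.
  by rewrite lerDl !addr_ge0//; do ?[apply: sumr_ge0 => ? _].
set V := pathprod _ w.
have VU : V <= #|{: wagers r L}|%:R * wager_mixture r a L w.
  rewrite /wager_mixture mulrA mulfV ?mul1r ?pnatr_eq0 -?lt0n ?card_wagers_gt0//.
  rewrite (bigD1 phi)//= lerDl; apply: sumr_ge0 => psi _.
  by apply: (bet_supermartingale _ _ _).1 => s; exact: norm_stake_of.
apply: le_trans VU _; rewrite card_wagers natrX mulrC ler_wpM2r ?exprn_ge0//.
rewrite -ler_pdivrMr ?ltr0n// -ler_pdivrMr ?ltr0n//; apply: le_trans TK.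
by rewrite /T /weight [leRHS]mulrC [X in _ <= _ * X]mulrC mulrA.
Qed.

End Bets.

(** * Real inequalities *)

Section RealBounds.
Variable R : realType.
Implicit Types (y M p : R).

(** Apply ln (1 + t) <= t at t = - y / (1 + y), where 1 + t is the inverse of 1 + y. *)
Lemma ln1D_ge y : `|y| <= 2^-1 -> y - 2 * y ^+ 2 <= ln (1 + y).
Proof.
rewrite ler_norml => /andP[yl yu].
have y1 : 0 < 1 + y by lra.
have h : ln (1 + y) = - ln (1 + - (y / (1 + y))).
  rewrite (_ : 1 + - (y / (1 + y)) = (1 + y)^-1) ?lnV ?opprK ?posrE//.
  by field; lra.
have le1 : ln (1 + - (y / (1 + y))) <= - (y / (1 + y)).
  apply: le_ln1Dx; rewrite ltrN2 ltr_pdivrMr//; lra.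
rewrite h; apply: (@le_trans _ _ (y / (1 + y))); last by lra.
rewrite ler_pdivlMr//; nra.
Qed.

Lemma ln_le_self y : 0 < y -> ln y <= y.
Proof.
move=> y0; have : ln (1 + (y - 1)) <= y - 1 by apply: le_ln1Dx; lra.
by rewrite addrC subrK; lra.
Qed.

Lemma prodr_nat_gt0 m n (F : nat -> R) : (forall i, (m <= i < n)%N -> 0 < F i) ->
  0 < \prod_(m <= i < n) F i.
Proof. by move=> F0; rewrite big_nat; apply: prodr_gt0 => i /F0. Qed.

Lemma ln_prod_nat m n (F : nat -> R) : (forall i, (m <= i < n)%N -> 0 < F i) ->
  ln (\prod_(m <= i < n) F i) = \sum_(m <= i < n) ln (F i).
Proof.
elim: n => [|n IH] F0; first by rewrite !big_geq// ln1.
have [mn|nm] := leqP m n; last by rewrite !big_geq// ln1.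
have F0' i : (m <= i < n)%N -> 0 < F i.
  by move=> /andP[mi i_n]; apply: F0; rewrite mi ltnW.
by rewrite !big_nat_recr//= lnM ?posrE ?prodr_nat_gt0 ?F0 ?mn ?leqnn// IH.
Qed.

(** A quadratic lower bound on the log-capital won at one context with stake mu, when the count
    deviates by M from its conditional mean v. *)
Definition gain (M v mu : R) : R := mu * M - 2 * mu ^+ 2 * (v + `|M|).

Lemma gain0 M v : gain M v 0 = 0.
Proof. by rewrite /gain mul0r expr0n mulr0 mul0r subrr. Qed.

Lemma gain_sign M v (mu : R) : 0 <= mu ->
  gain M v ((-1) ^+ (M < 0)%R * mu) = gain `|M| v mu.
Proof.
move=> mu0; rewrite /gain normr_id exprMn sqrr_sign mul1r; congr (_ - _).
by case: ltrP => M0; rewrite ?expr0 ?expr1 ?(ltr0_norm M0) ?(ger0_norm M0)/=; ring.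
Qed.

(** The least admissible j works: minimality gives the upper bound, except for j = 1, where it
    follows from y <= 1/4. *)
Lemma dyadic_scale (L : nat) (y : R) : 2^-1 ^+ L.+1 <= y -> y <= 4^-1 ->
  exists j : nat, [/\ (0 < j <= L.+1)%N, 2^-1 ^+ j.+1 <= y & y <= 2 * 2^-1 ^+ j.+1 ].
Proof.
move=> yL y4.
have ex : exists j, (0 < j)%N && (2^-1 ^+ j.+1 <= y).
  by exists L.+1; rewrite /=; apply: le_trans yL; rewrite exprS ler_piMl ?exprn_ge0//; lra.
case: (ex_minnP ex) => j /andP[j0 jy] jmin; exists j; split=> //.
  rewrite j0 /=; apply: jmin => /=; apply: le_trans yL.
  by rewrite exprS ler_piMl ?exprn_ge0//; lra.
case: j j0 jy jmin => // -[|j] _ jy jmin; first by move: y4; rewrite !exprS expr0; lra.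
rewrite exprS mulrA divff ?mul1r//; apply: ltW; rewrite ltNge; apply/negP => h.
by have := jmin j.+1; rewrite /= h => /(_ isT); rewrite ltnn.
Qed.

(* The stake e1, dyadically close to |M| / (8 N p), serves deviations
   |M| <= 2 N p; e2 serves larger ones, for which it is +- 1/4. *)
Lemma chi2_le_gain (L : nat) (N Na p delta : R) :
  0 < delta -> 0 <= Na <= N -> 0 <= p <= 1 -> (0 < p -> delta <= p) ->
  8 * N <= 2 ^+ L.+1 ->
  exists (e1 : bool * 'I_L.+2) (e2 : bool * 'I_2),
    (Na - N * p) ^+ 2 / (N * p) <=
      1 + 64 * gain (Na - N * p) (N * p) (stake R e1)
        + 16 / delta * gain (Na - N * p) (N * p) (stake R e2).
Proof.
move=> d0 /andP[Na0 NaN] /andP[p0 p1] dp NL.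
set M := Na - N * p; set v := N * p.
have N0 : 0 <= N by lra.
have v0 : 0 <= v by rewrite mulr_ge0.
have vN : v <= N by rewrite ler_piMr.
have MN : `|M| <= N by rewrite ler_norml /M -/v; lra.
have M0 : 0 <= `|M| by [].
pose z L : bool * 'I_L.+1 := (true, ord0).
have sz l : stake R (z l) = 0 by rewrite /stake eqxx.
have [ve|vp] := eqVneq v 0.
  by exists (z _), (z _); rewrite !sz !gain0 ve invr0 !mulr0; lra.
have {}vp : 0 < v by rewrite lt_def vp.
have N0' : 0 < N by lra.
have p0' : 0 < p by move: vp; rewrite /v pmulr_rgt0.
(* Deviations with M^2 <= v need no bet; they are the source of the constant 1. *)
have [Mv|vM] := leP (M ^+ 2) v.
  exists (z _), (z _); rewrite !sz !gain0 !mulr0 !addr0.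
  by rewrite ler_pdivrMr// mul1r.
rewrite -(@real_normK _ M) ?num_real// in vM *.
have M1 : 0 < `|M| by rewrite lt_def M0 andbT; apply/eqP => e; move: vM; rewrite e expr0n/=; lra.
have [Mg|Mb] := leP `|M| (2 * v).
  pose y := `|M| / (8 * v).
  have y4 : y <= 4^-1 by rewrite /y ler_pdivrMr; lra.
  (* As M^2 > v, the product of y and 8 |M| is at least 1, while 8 |M| <= 8 N <= 2 ^ (L + 1). *)
  have yL : 2^-1 ^+ L.+1 <= y.
    rewrite exprVn -[leLHS]mul1r ler_pdivrMr ?exprn_gt0//.
    apply: le_trans (_ : y * (8 * `|M|) <= _); last first.
      by rewrite ler_wpM2l ?divr_ge0; lra.
    rewrite /y mulrAC ler_pdivlMr; nra.
  have [j [/andP[j0 jL] jy yj]] := dyadic_scale yL y4.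
  have jL' : (j < L.+2)%N by rewrite ltnS.
  exists (M < 0, Ordinal jL'), (z _); rewrite sz gain0 mulr0 addr0.
  have -> : stake R (M < 0, Ordinal jL') = (-1) ^+ (M < 0)%R * 2^-1 ^+ j.+1.
    by rewrite /stake /= -val_eqE/= eqn0Ngt j0.
  rewrite gain_sign ?exprn_ge0// ?invr_ge0//.
  set m := _ ^+ j.+1 in jy yj *.
  have m0 : 0 <= m by rewrite exprn_ge0// invr_ge0.
  have m4 : m <= 4^-1 by lra.
  have yv : `|M| = 8 * v * y by rewrite /y mulrC divfK//; lra.
  rewrite /gain normr_id.
  have -> : `|M| ^+ 2 / v = 64 * v * y ^+ 2 by rewrite yv; field; lra.
  rewrite {}yv.
  (* The chi-square term is 64 v y^2, and a dyadic stake m between y / 2 and y gains at least v y^2,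
     because 1 + 8 y <= 3. *)
  suff : v * y ^+ 2 <= m * (8 * v * y) - 2 * m ^+ 2 * (v + 8 * v * y) by lra.
  rewrite (_ : _ - _ = v * (m * (8 * y) - 2 * m ^+ 2 * (1 + 8 * y))); last by ring.
  rewrite ler_wpM2l//.
  have ym : y * y <= 4 * (m * m) by apply: (le_trans (ler_pM _ _ yj yj)); lra.
  have : m * m * (8 * y) <= m * m * 2 by rewrite ler_wpM2l ?mulr_ge0//; lra.
  have : m * m <= m * y by rewrite ler_wpM2l.
  have : y * y <= 2 * m * y by rewrite ler_wpM2r//; lra.
  rewrite !expr2; lra.
(* Now v < |M| / 2, so the stake 1/4 gains at least |M| / 16. The chi-square term is at most |M| /
   delta, since |M| <= N and p >= delta. *)
exists (z _), (M < 0, @Ordinal 2 1 isT); rewrite sz gain0 mulr0 addr0.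
have -> : stake R (M < 0, @Ordinal 2 1 isT) = (-1) ^+ (M < 0)%R * 2^-1 ^+ 2 by [].
rewrite gain_sign ?exprn_ge0// ?invr_ge0//.
have g16 : `|M| / 16 <= gain `|M| v (2^-1 ^+ 2) by rewrite /gain normr_id; nra.
have : 16 / delta * (`|M| / 16) <= 16 / delta * gain `|M| v (2^-1 ^+ 2).
  by rewrite ler_wpM2l// divr_ge0// ltW.
have : `|M| ^+ 2 / v <= `|M| / delta.
  rewrite ler_pdivrMr// mulrAC ler_pdivlMr// expr2 -!mulrA ler_wpM2l// /v mulrC.
  apply: (@le_trans _ _ (delta * N)); first by rewrite ler_wpM2l// ltW.
  by rewrite mulrC ler_wpM2l// dp.
have -> : 16 / delta * (`|M| / 16) = `|M| / delta by field; lra.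
lra.
Qed.

End RealBounds.

(** * Transition counts *)

Section Counting.
Variables (R : realType) (S A : finType) (st : nat -> S) (x : nat -> A) (m n : nat).

Definition visits (s : S) : R := \sum_(m <= i < n) (st i == s)%:R.
Definition moves (s : S) (b : A) : R :=
  \sum_(m <= i < n) ((st i == s) && (x i == b))%:R.

Lemma sum_by_moves (F : S -> A -> R) :
  \sum_(m <= i < n) F (st i) (x i) = \sum_s \sum_b moves s b * F s b.
Proof.
under [RHS]eq_bigr do under eq_bigr do rewrite /moves mulr_suml.
under [RHS]eq_bigr do rewrite exchange_big/=.
rewrite exchange_big/=; apply: eq_bigr => i _.
rewrite (bigD1 (st i))//= (bigD1 (x i))//= !eqxx mul1r big1 ?addr0; last first.
  by move=> b /negbTE; rewrite eq_sym => ->; rewrite andbF mul0r.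
rewrite big1 ?addr0// => s /negbTE; rewrite eq_sym => ->.
by rewrite big1// => b _; rewrite mul0r.
Qed.

Lemma moves_ge0 s b : 0 <= moves s b.
Proof. by apply: sumr_ge0 => i _; rewrite ler0n. Qed.

Lemma sum_moves s : \sum_b moves s b = visits s.
Proof.
rewrite /moves exchange_big/=; apply: eq_bigr => i _.
rewrite (bigD1 (x i))//= eqxx andbT big1 ?addr0// => b /negbTE.
by rewrite eq_sym => ->; rewrite andbF.
Qed.

Lemma moves_le_visits s b : moves s b <= visits s.
Proof.
by rewrite -sum_moves (bigD1 b)//= lerDl sumr_ge0// => c _; exact: moves_ge0.
Qed.

Lemma visits_ge0 s : 0 <= visits s.
Proof. by apply: sumr_ge0 => i _; rewrite ler0n. Qed.

Lemma visits_le s : visits s <= (n - m)%:R.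
Proof.
apply: (@le_trans _ _ (\sum_(m <= i < n) 1)).
  by apply: ler_sum => i _; case: (_ == _).
by rewrite big_const_nat iter_addr_0.
Qed.

Lemma sum_visits : \sum_s visits s = (n - m)%:R.
Proof.
rewrite /visits exchange_big/= (eq_bigr (fun=> 1)).
  by rewrite big_const_nat iter_addr_0.
move=> i _; rewrite (bigD1 (st i))//= eqxx big1 ?addr0// => s /negbTE.
by rewrite eq_sym => ->.
Qed.

Lemma moves_gt0 s b : 0 < moves s b ->
  exists i, [/\ (m <= i < n)%N, st i = s & x i = b].
Proof.
move=> h; apply: contrapT => ne.
suff h0 : moves s b = 0 by move: h; rewrite h0 ltxx.
rewrite /moves big_nat big1// => i imn; case: eqP => //= si; case: eqP => //= xi.
by exfalso; apply: ne; exists i.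
Qed.

(** By [ln1D_ge], each logarithm is at least y - 2 y^2 for the bet y. At one context, with N visits,
    the bets sum to mu M and their squares to mu^2 (M (1 - 2 p) + N p - N p^2), which is at most
    mu^2 (N p + |M|). *)
Lemma sum_gain_le_ln (p : S -> R) (a : A) (mu : S -> R) :
  (forall s, 0 <= p s <= 1) -> (forall s, `|mu s| <= 4^-1) ->
  \sum_s gain (moves s a - visits s * p s) (visits s * p s) (mu s) <=
  \sum_(m <= i < n) ln (1 + mu (st i) * ((x i == a)%:R - p (st i))).
Proof.
move=> p01 mu4.
pose y s b := mu s * ((b == a)%:R - p s).
apply: (@le_trans _ _ (\sum_(m <= i < n) (y (st i) (x i) - 2 * y (st i) (x i) ^+ 2))); last first.
  apply: ler_sum => i _; apply: ln1D_ge; rewrite /y normrM.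
  have := mu4 (st i); have := p01 (st i) => /andP[p0 p1] m4.
  have : `|(x i == a)%:R - p (st i)| <= 1 by rewrite ler_norml; case: eqP => _ /=; lra.
  move: (`|_ - _|) (normr_ge0 ((x i == a)%:R - p (st i))) (`|mu _|) (normr_ge0 (mu (st i))) m4.
  by move=> u u0 v v0 v4 u1; nra.
rewrite (sum_by_moves (fun s b => y s b - 2 * y s b ^+ 2)); apply: ler_sum => s _.
rewrite (bigD1 a)//= (eq_bigr (fun b => moves s b * (- (mu s * p s) - 2 * (mu s * p s) ^+ 2))); last first.
  by move=> b /negbTE ba; rewrite /y ba sub0r mulrN sqrrN.
rewrite -mulr_suml.
have -> : \sum_(b | b != a) moves s b = visits s - moves s a.
  by rewrite -sum_moves [X in _ = X - _](bigD1 a)//= addrAC subrr add0r.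
rewrite /y eqxx /gain.
have /andP[p0 p1] := p01 s.
have := moves_le_visits s a; have := moves_ge0 s a.
move: (moves s a) (visits s) (mu s) (p s) p0 p1 => Na N u t t0 t1 Na0 NaN.
set M := Na - N * t.
have MM : M * (1 - 2 * t) <= `|M|.
  apply: le_trans (ler_norm _) _; rewrite normrM ler_piMr// ler_norml; lra.
have Nt2 : 0 <= N * t ^+ 2 by rewrite mulr_ge0 ?exprn_ge0//; lra.
have : u ^+ 2 * (M * (1 - 2 * t) + N * t - N * t ^+ 2) <= u ^+ 2 * (N * t + `|M|).
  by rewrite ler_wpM2l ?sqr_ge0//; lra.
have -> : u ^+ 2 * (M * (1 - 2 * t) + N * t - N * t ^+ 2) =
  (u * M - (Na * (u * (1 - t) - 2 * (u * (1 - t)) ^+ 2) +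
   (N - Na) * (- (u * t) - 2 * (u * t) ^+ 2))) / 2 by rewrite /M; field.
rewrite mulr1n; lra.
Qed.

(** A Hellinger bound: with Q = a^2 and u = b^2, the left side is at most 2 a b - 2 b^2 = Q - u - (a
    - b)^2, and (a^2 - b^2)^2 <= 4 (a - b)^2 as a and b are at most 1. *)
Lemma entropy_term (u Q : R) : 0 <= u <= 1 -> 0 <= Q <= 1 -> (0 < u -> 0 < Q) ->
  u * (ln Q - ln u) <= Q - u - (Q - u) ^+ 2 / 4.
Proof.
move=> /andP[u0 u1] /andP[Q0 Q1] uQ; have [->|un] := eqVneq u 0; first by nra.
have up : 0 < u by rewrite lt_def un.
have Qp := uQ up.
have [a a0 ea] : exists2 a, 0 < a & Q = a ^+ 2.
  by exists (Num.sqrt Q); rewrite ?sqrtr_gt0// sqr_sqrtr.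
have [b b0 eb] : exists2 b, 0 < b & u = b ^+ 2.
  by exists (Num.sqrt u); rewrite ?sqrtr_gt0// sqr_sqrtr// ltW.
rewrite ea eb in Q1 u1 *.
have l : ln a - ln b <= a / b - 1.
  rewrite -ln_div ?posrE// -{1}(subrKC 1 (a / b)) le_ln1Dx//.
  by rewrite ltrBrDl addrN divr_gt0.
have a1 : a <= 1 by rewrite -(@expr_le1 _ 2)// ltW.
have b1 : b <= 1 by rewrite -(@expr_le1 _ 2)// ltW.
have : b ^+ 2 * (ln (a ^+ 2) - ln (b ^+ 2)) <= 2 * a * b - 2 * b ^+ 2.
  rewrite !lnXn//; have : b ^+ 2 * (ln a - ln b) <= b ^+ 2 * (a / b - 1) by rewrite ler_wpM2l ?sqr_ge0.
  rewrite (_ : b ^+ 2 * (a / b - 1) = a * b - b ^+ 2); first by lra.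
  by field; lra.
suff : (a ^+ 2 - b ^+ 2) ^+ 2 / 4 <= (a - b) ^+ 2 by nra.
rewrite ler_pdivrMr// subr_sqr exprMn ler_wpM2l ?sqr_ge0//; nra.
Qed.

(** Relative entropy is at most chi-square, term by term: ln t <= t - 1 at t = u / p. *)
Lemma chi2_term (u p : R) : 0 <= u -> 0 <= p -> (0 < u -> 0 < p) ->
  u * (ln u - ln p) <= (u - p) ^+ 2 / p + u - p.
Proof.
move=> u0 p0 up; have [->|un] := eqVneq u 0.
  rewrite mul0r sub0r sqrrN addr0; have [->|pn] := eqVneq p 0; first by rewrite expr0n/= mul0r subrr.
  by rewrite expr2 mulfK// subrr.
have u1 : 0 < u by rewrite lt_def un.
have p1 := up u1.
have l : ln u - ln p <= u / p - 1.
  rewrite -ln_div ?posrE// -{1}(subrKC 1 (u / p)) le_ln1Dx//.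
  by rewrite ltrBrDl addrN divr_gt0.
rewrite (_ : (u - p) ^+ 2 / p + u - p = u * (u / p - 1)); last by field; lra.
by rewrite ler_wpM2l.
Qed.

(** The empirical frequencies u are inserted between Q and p. Passing from p to u gains at most
    chi-square ([chi2_term]), passing from u to Q loses a squared distance ([entropy_term]); the
    linear terms have nonpositive sum because Q sums to at most 1. *)
Lemma loglik_ratio_le (Q p : S -> A -> R) :
  (forall s b, 0 <= Q s b <= 1) -> (forall s, \sum_b Q s b <= 1) ->
  (forall s b, 0 <= p s b) -> (forall s, 0 < visits s -> \sum_b p s b = 1) ->
  (forall s b, 0 < moves s b -> 0 < Q s b /\ 0 < p s b) ->
  \sum_(m <= i < n) ln (Q (st i) (x i)) - \sum_(m <= i < n) ln (p (st i) (x i)) <=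
  \sum_s (\sum_b (moves s b - visits s * p s b) ^+ 2 / (visits s * p s b) -
    visits s * (\sum_b (moves s b / visits s - Q s b) ^+ 2) / 4).
Proof.
move=> Q01 Q1 p0 p1 pos.
rewrite -sumrB (sum_by_moves (fun s b => ln (Q s b) - ln (p s b))).
apply: ler_sum => s _; have [v0|vn] := eqVneq (visits s) 0.
  rewrite v0 !mul0r subr0; rewrite le_eqVlt; apply/orP; left; apply/eqP.
  apply: eq_bigr => b _; suff -> : moves s b = 0 by rewrite !mul0r subr0 expr0n/= mul0r.
  by apply/eqP; rewrite eq_le moves_ge0 andbT -v0 moves_le_visits.
have vp : 0 < visits s by rewrite lt_def vn visits_ge0.
pose u b := moves s b / visits s.
have ub b : moves s b = visits s * u b by rewrite /u mulrC divfK.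
have u01 b : 0 <= u b <= 1.
  by rewrite /u divr_ge0 ?moves_ge0 ?visits_ge0//= ler_pdivrMr// mul1r moves_le_visits.
have upos b : 0 < u b -> 0 < Q s b /\ 0 < p s b.
  by move=> ?; apply: pos; rewrite ub mulr_gt0.
have su : \sum_b u b = 1 by rewrite -mulr_suml sum_moves divff.
apply: (@le_trans _ _ (\sum_b visits s * ((Q s b - u b - (Q s b - u b) ^+ 2 / 4) +
   ((u b - p s b) ^+ 2 / p s b + u b - p s b)))).
  apply: ler_sum => b _; rewrite {1}ub -mulrA ler_wpM2l ?visits_ge0//.
  have /andP[ub0 ub1] := u01 b.
  have e1 := entropy_term (u01 b) (Q01 s b) (fun h => (upos b h).1).
  have e2 := chi2_term ub0 (p0 s b) (fun h => (upos b h).2).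
  rewrite -(subrKA (ln (u b))) mulrDr; exact: lerD.
have -> : \sum_b (moves s b - visits s * p s b) ^+ 2 / (visits s * p s b) =
    \sum_b visits s * ((u b - p s b) ^+ 2 / p s b).
  apply: eq_bigr => b _; rewrite ub -mulrBr exprMn invfM.
  by rewrite [_ * (_ * _^-1)]mulrACA expr2 mulfK//; congr (_ * _); rewrite mulrC.
rewrite -!mulr_sumr -mulrA -mulrBr ler_wpM2l ?visits_ge0//.
rewrite big_split/= !sumrB !big_split /= su p1// -mulr_suml.
have -> : \sum_b (moves s b / visits s - Q s b) ^+ 2 = \sum_b (Q s b - u b) ^+ 2.
  by apply: eq_bigr => b _; rewrite -[RHS]sqrrN opprB.
by have := Q1 s; lra.
Qed.

End Counting.

(** * The chi-square statistic along a path *)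

Section TypicalPath.
Variables (R : realType) (A : finType) (a0 : A).
Variables (rs : nat) (q : seq A -> A -> R) (x : Omega a0).
Hypothesis q01 : forall s a, 0 <= q s a <= 1.

(* Meaningful for k <= i only. *)
Definition ctx (k i : nat) : k.-tuple A :=
  insubd (nseq_tuple k a0) (block x (i - k) i).

Lemma val_ctx k i : (k <= i)%N -> val (ctx k i) = block x (i - k) i.
Proof. by move=> ki; rewrite val_insubd size_block subKn ?eqxx. Qed.

Definition trans (k : nat) (s : k.-tuple A) (b : A) : R := q (suffix_of rs s) b.

Lemma trans_ctx k i b : (rs <= k <= i)%N ->
  trans (ctx k i) b = q (block x (i - rs) i) b.
Proof.
move=> /andP[rk ki]; rewrite /trans val_ctx// suffix_of_block//; lia.
Qed.

(* As x / 0 = 0, contexts never visited and impossible letters count for 0. *)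
Definition chi2 (k n : nat) (b : A) : R :=
  \sum_(s : k.-tuple A)
    (moves R (ctx k) x k n s b - visits R (ctx k) k n s * trans s b) ^+ 2 /
    (visits R (ctx k) k n s * trans s b).

(** The almost sure event of [bets_bounded], imposed on the fixed path x. *)
Definition bets_bound (K : R) := forall r a L (phi : wagers A r L) n,
    pathprod a0 (bet rs q r a (stake_of R phi)) (block x 0 n) <=
    K * (r.+1 * r.+2)%:R * (L.+1 * L.+2)%:R * (2 * L.+1)%:R ^+ (#|A| ^ r).

Lemma sum_gain_le (K : R) k n a L (phi : wagers A k L) :
  (rs <= k)%N -> 0 < K -> bets_bound K ->
  \sum_(s : k.-tuple A)
     gain (moves R (ctx k) x k n s a - visits R (ctx k) k n s * trans s a)
          (visits R (ctx k) k n s * trans s a) (stake R (phi s)) <=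
  ln (K * (k.+1 * k.+2)%:R * (L.+1 * L.+2)%:R * (2 * L.+1)%:R ^+ (#|A| ^ k)).
Proof.
move=> rk K0 KB.
have mx : maxn k rs = k by apply/maxn_idPl.
pose g i := 1 + stake R (phi (ctx k i)) * ((x i == a)%:R - trans (ctx k i) a).
have g0 i : 0 < g i.
  have := norm_stake R (phi (ctx k i)); have := q01 (suffix_of rs (ctx k i)) a.
  rewrite -/(trans _ _) /g => /andP[t0 t1] s4.
  have : `|stake R (phi (ctx k i)) * ((x i == a)%:R - trans (ctx k i) a)| <= 4^-1.
    rewrite normrM; apply: le_trans s4; rewrite ler_piMr// ler_norml.
    by case: eqP => _; rewrite ?mulr1n ?mulr0n; lra.
  by rewrite ler_norml; lra.
apply: le_trans (@sum_gain_le_ln R _ _ (ctx k) x k n (fun s => trans s a) a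
  (fun s => stake R (phi s)) (fun s => q01 _ _) (fun s => norm_stake _ _)) _.
rewrite -/(g _).
have gP : \prod_(k <= i < n) g i <=
   K * (k.+1 * k.+2)%:R * (L.+1 * L.+2)%:R * (2 * L.+1)%:R ^+ (#|A| ^ k).
  (* If n <= k the product is empty and equals the capital at time 0. Otherwise the factors before
     time k are 1, as no bet is placed yet. *)
  have [nk|kn] := leqP n k.
    apply: le_trans (KB k a L phi 0%N); rewrite pathprod_block big_nil.
    by rewrite big_geq.
  apply: le_trans (KB k a L phi n); rewrite pathprod_block.
  rewrite [leRHS](@big_cat_nat _ _ _ k)//= ?(ltnW kn)//.
  rewrite [X in _ <= X * _]big_nat [X in _ <= X * _]big1 ?mul1r; last first.
    by move=> i /andP[_ ik]; rewrite /bet size_block subn0 mx ik.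
  rewrite le_eqVlt; apply/orP; left; apply/eqP.
  apply: eq_big_nat => i /andP[ki _].
  rewrite /bet size_block subn0 mx ltnNge ki/= /g.
  rewrite -stake_of_tuple val_ctx// trans_ctx ?rk// !suffix_of_block// ?add0n//.
  exact: leq_trans rk ki.
rewrite -(@ln_prod_nat R k n g (fun i _ => g0 i)) ler_ln// posrE; first exact: prodr_nat_gt0.
by rewrite !mulr_gt0 ?exprn_gt0 ?ltr0n.
Qed.

(** The stakes of [chi2_le_gain] are chosen context by context in hindsight. They assemble into two
    wagers, and the bound on bets holds for every wager at once. *)
Lemma chi2_le (K delta : R) k n a L :
  (rs <= k)%N -> 0 < K -> bets_bound K -> 0 < delta ->
  (forall (s : k.-tuple A), 0 < trans s a -> delta <= trans s a) ->
  (8 * n <= 2 ^ L.+1)%N ->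
  chi2 k n a <= (#|A| ^ k)%:R
    + 64 * ln (K * (k.+1 * k.+2)%:R * (L.+2 * L.+3)%:R * (2 * L.+2)%:R ^+ (#|A| ^ k))
    + 16 / delta * ln (K * (k.+1 * k.+2)%:R * (2 * 3)%:R * (2 * 2)%:R ^+ (#|A| ^ k)).
Proof.
move=> rk K0 KB d0 dl nL.
have ch (s : k.-tuple A) : exists e : (bool * 'I_L.+2) * (bool * 'I_2),
    (moves R (ctx k) x k n s a - visits R (ctx k) k n s * trans s a) ^+ 2 /
    (visits R (ctx k) k n s * trans s a) <=
   1 + 64 * gain (moves R (ctx k) x k n s a - visits R (ctx k) k n s * trans s a)
          (visits R (ctx k) k n s * trans s a) (stake R e.1)
     + 16 / delta * gain (moves R (ctx k) x k n s a - visits R (ctx k) k n s * trans s a)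
          (visits R (ctx k) k n s * trans s a) (stake R e.2).
  have mv : 0 <= moves R (ctx k) x k n s a <= visits R (ctx k) k n s.
    by rewrite moves_ge0 moves_le_visits.
  have v8 : 8 * visits R (ctx k) k n s <= 2 ^+ L.+1.
    apply: (@le_trans _ _ (8 * n%:R)).
      by rewrite ler_wpM2l// (le_trans (visits_le _ _ _ _ _))// ler_nat leq_subr.
    by rewrite -natrM -natrX ler_nat.
  have [e1 [e2 h]] := chi2_le_gain d0 mv (q01 _ _) (dl s) v8.
  by exists (e1, e2).
have [phi phiP] := fin_all_exists ch.
pose p1 : wagers A k L.+1 := [ffun s => (phi s).1].
pose p2 : wagers A k 1 := [ffun s => (phi s).2].
have g1 := @sum_gain_le K k n a L.+1 p1 rk K0 KB.
have g2 := @sum_gain_le K k n a 1 p2 rk K0 KB.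
apply: (le_trans (ler_sum _ (fun s _ => phiP s))).
rewrite !big_split/= -!mulr_sumr; apply: lerD; first apply: lerD.
- by rewrite sumr_const card_tuple.
- rewrite ler_wpM2l//; apply: le_trans g1; apply: ler_sum => s _; by rewrite ffunE.
- rewrite ler_wpM2l//; first by rewrite divr_ge0// ltW.
  by apply: le_trans g2; apply: ler_sum => s _; rewrite ffunE.
Qed.

(** With at least two letters k < |A|^k, so the logarithms of the weights are absorbed by the number
    |A|^k of contexts. *)
Lemma ln_bets_bound (K : R) k L : (1 < #|A|)%N -> 0 < K ->
  ln (K * (k.+1 * k.+2)%:R * (L.+1 * L.+2)%:R * (2 * L.+1)%:R ^+ (#|A| ^ k))
  <= (#|A| ^ k)%:R * (`|ln K| + 2 + 3 * ln (2 * L.+1)%:R).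
Proof.
move=> A1 K0; set D := (#|A| ^ k)%N.
have kD : (k < D)%N by rewrite ltn_expl.
have kDR : k.+1%:R <= D%:R :> R by rewrite ler_nat.
have D1 : 1 <= D%:R :> R by rewrite ler1n (leq_trans _ kD).
rewrite !lnM ?posrE ?mulr_gt0 ?ltr0n ?exprn_gt0//.
have l0 : 0 <= ln (2 * L.+1)%:R :> R by rewrite ln_ge0// ler1n.
have lk : ln (k.+1 * k.+2)%:R <= 2 * D%:R :> R.
  rewrite natrM lnM ?posrE ?ltr0n//.
  have e1 : ln k.+1%:R <= k%:R :> R by rewrite -natr1 addrC le_ln1Dx// (lt_le_trans (ltrN10 R)).
  have e2 : ln k.+2%:R <= k.+1%:R :> R by rewrite -natr1 addrC le_ln1Dx// (lt_le_trans (ltrN10 R)).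
  by rewrite -natr1 in kDR e2; lra.
have lL : ln (L.+1 * L.+2)%:R <= 2 * ln (2 * L.+1)%:R :> R.
  rewrite [leRHS]mulr_natl -lnXn ?ltr0n// ler_ln ?posrE ?exprn_gt0 ?ltr0n//.
  by rewrite -natrX ler_nat; lia.
rewrite lnXn ?ltr0n// -[_ *+ D]mulr_natl.
have lK : ln K <= D%:R * `|ln K|.
  by apply: le_trans (ler_norm _) _; rewrite ler_peMl.
have : ln (2 * L.+1)%:R <= D%:R * ln (2 * L.+1)%:R :> R by rewrite ler_peMl.
nra.
Qed.

Lemma ln2_ge : 2^-1 <= ln (2 : R).
Proof.
have : ln (1 + - 2^-1) <= - 2^-1 :> R by apply: le_ln1Dx; lra.
by rewrite (_ : 1 + - 2^-1 = 2^-1) ?lnV ?posrE//; lra.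
Qed.

(** As ln 2 >= 1/2, the binary logarithm is at most 2 ln n. With 1 <= ln n the argument is at most 2
    (2 + 5) ln n, hence the 14. *)
Lemma ln_trunc_log n : 1 <= ln n%:R :> R ->
  ln (2 * (trunc_log 2 n + 5))%:R <= ln 14 + ln (ln n%:R) :> R.
Proof.
move=> l1; have n0 : (0 < n)%N by case: n l1 => //; rewrite ln0 ?ler10.
have tl : (trunc_log 2 n)%:R <= 2 * ln n%:R :> R.
  have : ln (2 ^ trunc_log 2 n)%:R <= ln n%:R :> R.
    by rewrite ler_ln ?posrE ?ltr0n ?expn_gt0// ler_nat trunc_logP.
  rewrite natrX lnXn// -[ln 2 *+ _]mulr_natl => h.
  have := ler_wpM2l (ler0n R (trunc_log 2 n)) ln2_ge.
  lra.
rewrite -lnM ?posrE//; last by lra.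
rewrite ler_ln ?posrE ?ltr0n//; last 2 first.
- by lia.
- by rewrite mulr_gt0//; lra.
by rewrite natrM natrD; lra.
Qed.

(** The factor 192 is 64 from the fine stakes times 3 from [ln_bets_bound]; the coarse stakes have L
    = 1 and enter only C. *)
Lemma chi2_loglog (K delta : R) : (1 < #|A|)%N -> 0 < K -> bets_bound K -> 0 < delta ->
  (forall k (s : k.-tuple A) a, (rs <= k)%N -> 0 < trans s a -> delta <= trans s a) ->
  exists2 C, 0 <= C & forall k n a, (rs <= k)%N -> 1 <= ln n%:R :> R ->
    chi2 k n a <= (#|A| ^ k)%:R * (192 * ln (ln n%:R) + C).
Proof.
move=> A1 K0 KB d0 dl.
exists (1 + 64 * (`|ln K| + 2 + 3 * ln 14) + 16 / delta * (`|ln K| + 2 + 3 * ln 4)).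
  have l14 : 0 <= ln 14 :> R by rewrite ln_ge0// ler1n.
  have l4 : 0 <= ln 4 :> R by rewrite ln_ge0// ler1n.
  have K' : 0 <= `|ln K| by [].
  have : 0 <= 16 / delta * (`|ln K| + 2 + 3 * ln 4).
    by rewrite mulr_ge0 ?divr_ge0 ?(ltW d0)//; lra.
  lra.
move=> k n a rk l1.
(* From n < 2 ^ ([trunc_log 2 n] + 1), adding 3 to the exponent gives 8 n <= 2 ^ (L + 1). *)
pose L := (trunc_log 2 n + 3)%N.
have nL : (8 * n <= 2 ^ L.+1)%N.
  have := @trunc_log_ltn 2 n isT.
  by rewrite /L -addnS expnD expnS (_ : 2 ^ 4 = 16)%N//; lia.
have := @chi2_le K delta k n a L rk K0 KB d0 (fun s => dl k s a rk) nL.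
move/le_trans; apply.
have b1 := @ln_bets_bound K k L.+1 A1 K0.
have b2 := @ln_bets_bound K k 1 A1 K0.
have b3 := ln_trunc_log l1.
rewrite (_ : trunc_log 2 n + 5 = L.+2)%N in b3; last by rewrite /L; lia.
set D := (#|A| ^ k)%:R in b1 b2 *.
have D0 : 0 <= D by [].
have b1' : 64 * ln (K * (k.+1 * k.+2)%:R * (L.+2 * L.+3)%:R * (2 * L.+2)%:R ^+ (#|A| ^ k)) <=
   D * (64 * (`|ln K| + 2 + 3 * (ln 14 + ln (ln n%:R)))).
  rewrite mulrCA ler_wpM2l//; apply: (le_trans b1); rewrite ler_wpM2l//; lra.
have b2' : 16 / delta * ln (K * (k.+1 * k.+2)%:R * (2 * 3)%:R * (2 * 2)%:R ^+ (#|A| ^ k)) <=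
   D * (16 / delta * (`|ln K| + 2 + 3 * ln 4)).
  by rewrite mulrCA ler_wpM2l ?divr_ge0 ?(ltW d0).
apply: le_trans (lerD (lerD (lexx D) b1') b2') _.
by rewrite le_eqVlt; apply/orP; left; apply/eqP; ring.
Qed.

End TypicalPath.

(** * Stationary chains and competing laws *)

Section StationaryLaw.
Variables (R : realType) (A : finType) (a0 : A) (P : probability (Omega a0) R).

(** There are countably many null words, hence the paths starting with one of them form a null
    set. *)
Lemma wprob_pos_prefixes : {ae P, forall x : Omega a0, forall n, 0 < wprob P (block x 0 n)}.
Proof.
pose F k : set (Omega a0) := if unpickle k is Some w then
  (if wprob P w == 0 then block_event a0 0 (size w) w else set0) else set0.
have : P.-negligible (\bigcup_k F k).
  apply: negligible_bigcup => k; rewrite /F; case: unpickle => [w|]; last exact: negligible_set0.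
  case: ifPn => [/eqP w0|_]; last exact: negligible_set0.
  exists (block_event a0 0 (size w) w); split => //; first exact: measurable_block_event.
  rewrite -[LHS]fineK ?fin_num_measure//; last exact: measurable_block_event.
  by move: w0; rewrite /wprob => ->.
apply: negligibleS => x /= /existsNP[n /negP]; rewrite -leNgt => p0.
exists (pickle (block x 0 n)) => //; rewrite /F pickleK.
rewrite eq_le p0 wprob_ge0 /= size_block subn0.
by [].
Qed.

Lemma pos_event_word (E : set (Omega a0)) : measurable E -> 0 < fine (P E) ->
  exists2 y, E y & forall n, 0 < wprob P (block y 0 n).
Proof.
move=> mE PE; apply: contrapT => h.
have [N [mN N0 sub]] := wprob_pos_prefixes.
have EN : E `<=` N.
  by move=> y Ey; apply: sub => /= ypos; apply: h; exists y.
by have := prob_fine_le P mE mN EN; rewrite N0 /= leNgt PE.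
Qed.

Hypothesis statP : stationary P.

Lemma block_event_stationary j m n w :
  P (block_event a0 (m + j) (n + j) w) = P (block_event a0 m n w).
Proof.
elim: j => [|j IH]; first by rewrite !addn0.
rewrite -IH -(statP (measurable_block_event (m + j) (n + j) w)) !addnS; congr (P _).
have e (x : Omega a0) : block x (m + j).+1 (n + j).+1 = block (Defs.shift x) (m + j) (n + j).
  by rewrite /block /index_iota subSS -[(m + j).+1]add1n iotaDl -map_comp.
by apply/seteqP; split=> x; rewrite /block_event /= e.
Qed.

Lemma prob_block_event m n w : n = (m + size w)%N ->
  fine (P (block_event a0 m n w)) = wprob P w.
Proof.
move=> ->; rewrite addnC -{1}(add0n m); by rewrite block_event_stationary.
Qed.

Lemma sum_wprob_cons w : \sum_b wprob P (b :: w) = wprob P w.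
Proof.
rewrite -(@prob_block_event 1 (size w).+1)//.
rewrite (total_prob P 0); last exact: measurable_block_event.
by apply: eq_bigr => b _; rewrite /wprob /= block_event_cons.
Qed.

Lemma wprob_rcons_le w b : wprob P (rcons w b) <= wprob P w.
Proof.
by rewrite -(sum_wprob_rcons P w) (bigD1 b)//= lerDl sumr_ge0// => c _; exact: wprob_ge0.
Qed.

Lemma wprob_cat_le u w : wprob P (u ++ w) <= wprob P w.
Proof.
elim: u => //= b u; apply: le_trans.
by rewrite -(sum_wprob_cons (u ++ w)) (bigD1 b)//= lerDl sumr_ge0// => c _; exact: wprob_ge0.
Qed.

Lemma wprob_suffix_le r w : wprob P w <= wprob P (suffix_of r w).
Proof. by rewrite -{1}(cat_take_drop (size w - r) w) wprob_cat_le. Qed.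

(* Takes the junk value 0 at a null context. *)
Definition tprob (s : seq A) (b : A) : R := wprob P (rcons s b) / wprob P s.

Lemma tprob01 s b : 0 <= tprob s b <= 1.
Proof.
rewrite /tprob divr_ge0 ?wprob_ge0//=; have [->|n0] := eqVneq (wprob P s) 0.
  by rewrite invr0 mulr0 ler01.
by rewrite ler_pdivrMr ?mul1r ?wprob_rcons_le// lt_def n0 wprob_ge0.
Qed.

Lemma sum_tprob s : 0 < wprob P s -> \sum_b tprob s b = 1.
Proof. by move=> s0; rewrite -mulr_suml sum_wprob_rcons divff// gt_eqF. Qed.

Lemma cond_prob_tprob m i s b : (m <= i)%N -> i = (m + size s)%N ->
  cond_prob P (block_event a0 i i.+1 [:: b]) (block_event a0 m i s) = tprob s b.
Proof.
move=> mi e; rewrite /cond_prob /tprob.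
have -> : block_event a0 i i.+1 [:: b] `&` block_event a0 m i s =
    block_event a0 m i.+1 (rcons s b).
  rewrite block_event_rcons// setIC; congr (_ `&` _).
  apply/seteqP; split=> x; rewrite /block_event /= block_cons// block_nil//.
    by case.
  by move=> ->.
by rewrite !prob_block_event// size_rcons addnS e.
Qed.

Lemma Theta_wprob r w b : Theta R a0 r P -> (r <= size w)%N ->
  wprob P (rcons w b) = wprob P w * tprob (suffix_of r w) b.
Proof.
(* The factorization in [Theta] is stated along infinite words, so [rcons w b] is padded with a0; it
   is then compared at two consecutive lengths. *)
move=> [fac _] rw; pose y : Omega a0 := fun i => nth a0 (rcons w b) i.
have yw : block y 0 (size w) = w.
  apply: (@eq_from_nth _ a0); rewrite size_block subn0// => i iw.
  by rewrite (nth_map 0%N) ?size_iota ?subn0// nth_iota ?subn0// /y nth_rcons iw.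
have yb : y (size w) = b by rewrite /y nth_rcons ltnn eqxx.
have ywb : block y 0 (size w).+1 = rcons w b by rewrite block_rcons// yw yb.
have := fac (size w).+1 y (leqW rw); rewrite big_nat_recr//= mulrA -(fac _ y rw).
rewrite ywb yw yb -(@prob_block_event 0 (size w).+1 (rcons w b)) ?size_rcons// => ->.
rewrite (@prob_block_event 0)// cond_prob_tprob ?leq_subr//; last first.
  by rewrite size_block; lia.
by rewrite -(@suffix_of_block _ _ y r 0)// yw.
Qed.

Lemma Theta_of_wprob r (g : seq A -> A -> R) :
  (forall w b, (r <= size w)%N -> wprob P (rcons w b) = wprob P w * g (suffix_of r w) b) ->
  Theta R a0 r P.
Proof.
move=> H.
have gt s b : size s = r -> 0 < wprob P s -> tprob s b = g s b.
  move=> sr s0; rewrite /tprob H ?sr// /suffix_of sr subnn drop0.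
  by rewrite mulrC mulKf// gt_eqF.
split=> [n x rn|]; last first.
  exists g => i s a ri sr s0.
  rewrite cond_prob_tprob ?leq_subr ?sr ?subnK// gt//.
  have := s0; rewrite -[P _]fineK ?fin_num_measure//; last exact: measurable_block_event.
  by rewrite prob_block_event ?sr ?subnK// lte_fin.
rewrite !prob_block_event ?size_block ?subn0//.
elim: n rn => [|n IH]; first by rewrite leqn0 => /eqP ->; rewrite big_geq// mulr1.
rewrite leq_eqVlt => /orP[/eqP <-|]; first by rewrite big_geq ?mulr1.
rewrite ltnS => rn; rewrite big_nat_recr//= mulrA -IH// block_rcons//.
rewrite cond_prob_tprob ?leq_subr ?size_block//; last by lia.
rewrite H ?size_block ?subn0// suffix_of_block ?add0n//.
have [->|n0] := eqVneq (wprob P (block x 0 n)) 0; first by rewrite !mul0r.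
rewrite gt ?size_block ?subKn//.
have := wprob_suffix_le r (block x 0 n); rewrite suffix_of_block ?add0n//.
by apply: lt_le_trans; rewrite lt_def n0 wprob_ge0.
Qed.

(** Otherwise the transition probabilities at charged contexts would depend on the last r letters
    only, and P would have order at most r. *)
Lemma order_witness rs r : markov_order P rs -> (r < rs)%N ->
  exists s s' : seq A, exists a : A,
    [/\ size s = rs /\ size s' = rs, suffix_of r s = suffix_of r s',
      0 < wprob P s, 0 < wprob P s' & tprob s a != tprob s' a].
Proof.
move=> [Ths min] rrs; apply: contrapT => h.
suff : Theta R a0 r P by move=> /min; rewrite leqNgt rrs.
pose D u := [set s : seq A | [/\ size s = rs, 0 < wprob P s & suffix_of r s = u]].
(* The common transition probability of the charged contexts ending in u, read at an arbitrary one
   of them. *)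
pose g u a := tprob (xget [::] (D u)) a.
have gP s a : size s = rs -> 0 < wprob P s -> tprob s a = g (suffix_of r s) a.
  move=> sr s0; rewrite /g; case: xgetP => [s' _ [s'r s'0 e]|/(_ s)]; last first.
    by move=> h0; exfalso; apply: h0.
  by apply: contrapT => /eqP ne; apply: h; exists s, s', a.
apply: (@Theta_of_wprob r g) => w b.
(* Words shorter than [rs] are treated by downward induction on length: stationarity allows summing
   over a letter put in front. *)
have [k le_k] := ubnP (rs - size w)%N.
elim: k w le_k => // k IH w; rewrite ltnS => le_k rw.
have [rsw|wrs] := leqP rs (size w).
  rewrite (Theta_wprob _ Ths rsw).
  have [->|n0] := eqVneq (wprob P w) 0; first by rewrite !mul0r.
  have ss : size (suffix_of rs w) = rs by rewrite /suffix_of size_drop subKn.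
  have s0 : 0 < wprob P (suffix_of rs w).
    by apply: lt_le_trans (wprob_suffix_le rs w); rewrite lt_def n0 wprob_ge0.
  rewrite (gP _ _ ss s0); congr (_ * g _ _).
  rewrite /suffix_of drop_drop size_drop subKn//; congr drop; lia.
rewrite -(sum_wprob_cons (rcons w b)) -(sum_wprob_cons w) mulr_suml.
apply: eq_bigr => c _; rewrite -rcons_cons IH/=; last by rewrite leqW.
  by congr (_ * g _ _); rewrite /suffix_of /= subSn.
lia.
Qed.

(** A positive probability is turned into one path with charged prefixes, so that all its
    transitions are possible. The case s = t, on which irreducibility is silent, takes k = 0. *)
Lemma irreducible_path rs s t : irreducible P rs -> size s = rs -> size t = rs ->
  0 < wprob P s -> 0 < wprob P t ->
  exists (y : Omega a0) (k : nat), [/\ block y 0 rs = s, block y k (k + rs) = t &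
    forall n, 0 < wprob P (block y 0 n)].
Proof.
move=> irr sr tr s0 t0.
have pE m n w : 0 < wprob P w -> n = (m + size w)%N -> (0 < P (block_event a0 m n w))%E.
  move=> w0 e; rewrite -[P _]fineK ?fin_num_measure//; last exact: measurable_block_event.
  by rewrite prob_block_event// lte_fin.
have [st|/eqP st] := eqVneq s t.
  have [|y] := @pos_event_word (block_event a0 0 rs s) (measurable_block_event _ _ _).
    by rewrite prob_block_event.
  by rewrite /block_event /= => ys ypos; exists y, 0%N; rewrite add0n -st.
have [k] := irr s t sr tr st (pE 0%N rs s s0 (esym sr)) (pE 0%N rs t t0 (esym tr)).
rewrite /cond_prob [fine (P (block_event a0 0 _ _))]prob_block_event//.
rewrite pmulr_lgt0 ?invr_gt0// => h.
have [||y [yt ys] ypos] := @pos_event_word (block_event a0 k (k + rs) t `&` block_event a0 0 rs s).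
- by apply: measurableI; exact: measurable_block_event.
- exact: h.
by exists y, k.
Qed.

End StationaryLaw.

Section Competitor.
Variables (R : realType) (A : finType) (a0 : A) (P : probability (Omega a0) R).

(** A competing law may be nonstationary, so its kernel comes from the definition of [Theta], set to
    0 at contexts that are never charged, where q is arbitrary. The initial probability is bounded
    by 1. *)
Lemma Theta_kernel r : Theta R a0 r P -> exists Q : seq A -> A -> R,
  [/\ forall s b, 0 <= Q s b <= 1, forall s, \sum_b Q s b <= 1 &
   forall (x : Omega a0) n, (r <= n)%N -> 0 < wprob P (block x 0 n) ->
     (forall i, (r <= i < n)%N -> 0 < Q (block x (i - r) i) (x i)) /\
     wprob P (block x 0 n) <= \prod_(r <= i < n) Q (block x (i - r) i) (x i)].
Proof.
move=> [fac [q qP]].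
pose charged s := `[< exists i, [/\ (r <= i)%N, size s = r &
   (0 < P (block_event a0 (i - r) i s))%E] >].
pose Q s b := if charged s then q s b else 0.
have cap i s b : (r <= i)%N -> block_event a0 i i.+1 [:: b] `&` block_event a0 (i - r) i s =
    block_event a0 (i - r) i s `&` [set x | x i = b].
  move=> ri; rewrite setIC; congr (_ `&` _).
  apply/seteqP; split=> x; rewrite /block_event /= block_cons// block_nil//; first by case.
  by move=> ->.
have mB := @measurable_block_event A a0.
have Q01 s b : 0 <= Q s b <= 1.
  rewrite /Q /charged; case: asboolP => [[i [ri sr s0]]|_]; last by rewrite lexx ler01.
  rewrite -(qP i s b ri sr s0) /cond_prob divr_ge0 ?fine_ge0//=.
  have s0' : 0 < fine (P (block_event a0 (i - r) i s)).
    by rewrite fine_gt0// s0 ltey_eq fin_num_measure.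
  rewrite ler_pdivrMr// mul1r; apply: prob_fine_le; [exact: measurableI|exact: mB|exact: subIsetr].
have Qsum s : \sum_b Q s b <= 1.
  rewrite /Q /charged; case: asboolP => [[i [ri sr s0]]|_]; last by rewrite big1.
  have s0' : 0 < fine (P (block_event a0 (i - r) i s)).
    by rewrite fine_gt0// s0 ltey_eq fin_num_measure.
  under eq_bigr do rewrite -(qP i s _ ri sr s0) /cond_prob cap//.
  by rewrite -mulr_suml -total_prob// divff// gt_eqF.
exists Q; split=> // x n rn.
have E0 : wprob P (block x 0 n) = fine (P (block_event a0 0 n (block x 0 n))).
  by rewrite /wprob size_block subn0.
move=> x0.
have posB i : (r <= i < n)%N -> (0 < P (block_event a0 (i - r) i (block x (i - r) i)))%E.
  move=> /andP[ri i_n]; rewrite -[P _]fineK ?fin_num_measure// lte_fin.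
  apply: lt_le_trans x0 _; rewrite E0; apply: prob_fine_le => // y.
  rewrite /block_event /= => yx; have nn := leq_subr r i.
  have := congr1 (drop (i - r)) (congr1 (take i) yx).
  rewrite !take_block ?(ltnW i_n)// !(@block_cat _ _ _ 0 (i - r) i) ?nn//.
  by rewrite !drop_size_cat// size_block subn0.
have eqQ i : (r <= i < n)%N -> Q (block x (i - r) i) (x i) =
    cond_prob P (block_event a0 i i.+1 [:: x i]) (block_event a0 (i - r) i (block x (i - r) i)).
  move=> irn; have /andP[ri i_n] := irn.
  have sb : size (block x (i - r) i) = r by rewrite size_block subKn.
  rewrite /Q ifT; first by rewrite (qP i)// posB.
  by apply/asboolP; exists i; split=> //; exact: posB.
have le1 : wprob P (block x 0 n) <= \prod_(r <= i < n) Q (block x (i - r) i) (x i).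
  rewrite E0 fac// (eq_big_nat _ _ (fun i irn => esym (eqQ i irn))) ler_piMl//.
    by rewrite big_nat; apply: prodr_ge0 => i _; case/andP: (Q01 (block x (i - r) i) (x i)).
  by rewrite -lee_fin fineK ?fin_num_measure// probability_le1.
split=> // i irn; rewrite lt_neqAle eq_sym; case/andP: (Q01 (block x (i - r) i) (x i)) => -> _.
rewrite andbT; apply/eqP => Qi0; move: (lt_le_trans x0 le1).
case/andP: irn => ri i_n.
rewrite (@big_cat_nat _ _ _ i)//= ?(ltnW i_n)// (big_ltn i_n) Qi0 mul0r mulr0 ltxx.
by [].
Qed.

End Competitor.

(** * Comparison of likelihoods and frequencies of contexts *)

Lemma finite_positive_lower_bound (R : realType) (T : finType) (F : T -> R) :
  exists2 d, 0 < d & forall t, 0 < F t -> d <= F t.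
Proof.
suff [d d0 dF] : exists2 d, 0 < d & forall t, t \in enum T -> 0 < F t -> d <= F t.
  by exists d => // t; apply: dF; rewrite mem_enum.
elim: (enum T) => [|t l [d d0 dF]]; first by exists 1.
have [Ft|Ft] := ltP 0 (F t); last first.
  exists d => // u; rewrite inE => /orP[/eqP -> /lt_le_trans /(_ Ft)|]; last exact: dF.
  by rewrite ltxx.
exists (Num.min d (F t)); first by rewrite lt_min d0.
move=> u; rewrite inE ge_min => /orP[/eqP ->|ul u0]; first by rewrite lexx orbT.
by rewrite (dF u ul u0).
Qed.

(** It suffices that ln ln n is at most 2 sqrt n. *)
Lemma loglog_sublinear (R : realType) (a b e : R) : 0 <= a -> 0 < e ->
  \forall n \near \oo, a * ln (ln (n%:R : R)) + b <= e * n%:R.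
Proof.
move=> a0 e0.
near=> n.
have n1 : 1 <= n%:R :> R by near: n; exact: nbhs_infty_ger.
have nb : 2 * b / e <= n%:R by near: n; exact: nbhs_infty_ger.
have na : (4 * a / e) ^+ 2 <= n%:R by near: n; exact: nbhs_infty_ger.
set s := Num.sqrt (n%:R : R).
have ns : n%:R = s ^+ 2 by rewrite sqr_sqrtr.
have s0 : 0 <= s by exact: sqrtr_ge0.
have s1 : 1 <= s by rewrite -(@sqrtr1 R) ler_wsqrtr.
have ll : ln (ln n%:R) <= 2 * s.
  have [l0|l0] := ltP 0 (ln n%:R : R); last first.
    by rewrite ln0//; lra.
  apply: le_trans (ln_le_self l0) _; rewrite ns lnXn ?(lt_le_trans ltr01)// -mulr_natl.
  by have := ln_le_self (lt_le_trans ltr01 s1); lra.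
have b2 : 2 * b <= e * n%:R by move: nb; rewrite ler_pdivrMr//; lra.
have a4 : 4 * a <= e * s.
  have : 4 * a / e <= s by rewrite -(@ler_pXn2r _ 2) ?nnegrE -?ns// divr_ge0 ?mulr_ge0 ?(ltW e0).
  by rewrite ler_pdivrMr//; lra.
have : a * ln (ln n%:R) <= a * (2 * s) by rewrite ler_wpM2l.
have : 4 * a * s <= e * s * s by rewrite ler_wpM2r.
have -> : e * s * s = e * n%:R by rewrite ns; ring.
lra.
Unshelve. all: by end_near.
Qed.

Section MarkovPath.
Variables (R : realType) (A : finType) (a0 : A) (P : probability (Omega a0) R).
Variables (rs : nat).
Hypothesis statP : stationary P.
Hypothesis ThP : Theta R a0 rs P.

Section OnePath.
Variable x : Omega a0.
Hypothesis xpos : forall n, 0 < wprob P (block x 0 n).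

Lemma block_pos i j : (i <= j)%N -> 0 < wprob P (block x i j).
Proof.
move=> ij; apply: lt_le_trans (xpos j) _.
rewrite (@block_cat _ _ x 0 i j) ?ij//; exact: wprob_cat_le.
Qed.

Lemma trans_pos k i : (rs <= k <= i)%N -> 0 < trans rs (tprob P) (ctx x k i) (x i).
Proof.
move=> rki; rewrite trans_ctx//; case/andP: rki => rk ki.
rewrite divr_gt0 ?block_pos ?leq_subr// -block_rcons ?leq_subr// block_pos//.
by rewrite leqW ?leq_subr.
Qed.

Lemma visits_pos k n (s : k.-tuple A) : (rs <= k)%N ->
  0 < visits R (ctx x k) k n s -> 0 < wprob P s.
Proof.
move=> rk; rewrite -(sum_moves R (ctx x k) x) => h.
have [b] : exists b, 0 < moves R (ctx x k) x k n s b.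
  apply: contrapT => /forallNP ne; move: h; rewrite big1 ?ltxx// => b _.
  by apply/eqP; rewrite eq_le moves_ge0 andbT leNgt; apply/negP/ne.
move=> /moves_gt0[i [/andP[ki _] <- _]].
by rewrite val_ctx// block_pos// leq_subr.
Qed.

Lemma ln_wprob k n : (rs <= k <= n)%N ->
  ln (wprob P (block x 0 n)) = ln (wprob P (block x 0 k)) +
    \sum_(k <= i < n) ln (trans rs (tprob P) (ctx x k i) (x i)).
Proof.
move=> /andP[rk]; elim: n => [|n IH]; first by rewrite leqn0 => /eqP ->; rewrite big_geq ?addr0.
rewrite leq_eqVlt => /orP[/eqP <-|]; first by rewrite big_geq ?addr0.
rewrite ltnS => kn; rewrite big_nat_recr//= addrA -IH// block_rcons//.
rewrite (Theta_wprob statP _ ThP) ?size_block ?subn0 ?(leq_trans rk)//.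
have tp := @trans_pos k n; rewrite rk kn in tp; have {}tp := tp isT.
rewrite lnM ?posrE//; first by rewrite suffix_of_block ?trans_ctx ?rk ?add0n// (leq_trans rk).
by move: tp; rewrite trans_ctx ?rk// suffix_of_block ?add0n// (leq_trans rk).
Qed.

(** Both laws are read through contexts of a common length k, so that [loglik_ratio_le] applies. The
    competitor gets the first k letters for free, which costs the initial term. *)
Lemma competitor_le r k (P' : probability (Omega a0) R) :
  Theta R a0 r P' -> (rs <= k)%N -> (r <= k)%N ->
  exists Q : seq A -> A -> R, forall n, (k <= n)%N -> 0 < wprob P' (block x 0 n) ->
    ln (wprob P' (block x 0 n)) <= ln (wprob P (block x 0 n)) - ln (wprob P (block x 0 k))
     + \sum_b chi2 rs (tprob P) x k n b
     - (\sum_(s : k.-tuple A) visits R (ctx x k) k n s *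
         \sum_b (moves R (ctx x k) x k n s b / visits R (ctx x k) k n s
                 - Q (suffix_of r s) b) ^+ 2) / 4.
Proof.
move=> /Theta_kernel[Q [Q01 Qsum QP]] rk rk'; exists Q => n kn P'x.
have [Qpos P'le] := QP x n (leq_trans rk' kn) P'x.
pose Qk (s : k.-tuple A) b := Q (suffix_of r s) b.
have Qctx i : (k <= i)%N -> Qk (ctx x k i) (x i) = Q (block x (i - r) i) (x i).
  by move=> ki; rewrite /Qk val_ctx// suffix_of_block//; lia.
have Qn i : (k <= i < n)%N -> 0 < Qk (ctx x k i) (x i).
  by move=> /andP[ki i_n]; rewrite Qctx// Qpos// i_n (leq_trans rk').
have lnQ : ln (wprob P' (block x 0 n)) <= \sum_(k <= i < n) ln (Qk (ctx x k i) (x i)).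
  have Qp : 0 < \prod_(k <= i < n) Qk (ctx x k i) (x i) by exact: prodr_nat_gt0.
  rewrite -(ln_prod_nat Qn).
  rewrite ler_ln ?posrE//; apply: (le_trans P'le).
  rewrite (@big_cat_nat _ _ _ k)//= ?rk'//.
  have -> : \prod_(k <= i < n) Q (block x (i - r) i) (x i) =
            \prod_(k <= i < n) Qk (ctx x k i) (x i).
    by apply: eq_big_nat => i /andP[ki _]; rewrite Qctx.
  rewrite ler_piMl ?(ltW Qp)//.
  by apply: prodr_ile1 => i _; exact: Q01.
have := @loglik_ratio_le R _ _ (ctx x k) x k n Qk (fun s => trans rs (tprob P) s)
  (fun s b => Q01 _ _) (fun s => Qsum _) (fun s b => (andP (tprob01 P _ _)).1).
have trsum s : 0 < visits R (ctx x k) k n s -> \sum_b trans rs (tprob P) s b = 1.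
  move=> /(visits_pos rk) s0; apply: sum_tprob.
  by apply: lt_le_trans s0 _; exact: wprob_suffix_le.
have mpos s b : 0 < moves R (ctx x k) x k n s b -> 0 < Qk s b /\ 0 < trans rs (tprob P) s b.
  move=> /moves_gt0[i [kin <- <-]]; split; first exact: Qn.
  by apply: trans_pos; case/andP: kin => -> _; rewrite rk.
move=> /(_ trsum mpos); rewrite sumrB.
rewrite (@ln_wprob k n) ?rk// -mulr_suml /chi2 [in X in _ -> X]exchange_big/=.
lra.
Qed.

(** Each transition costs at most |ln d|, where d is a lower bound on the positive transition
    probabilities. *)
Lemma wprob_lower : exists C : R, forall k, (rs <= k)%N ->
  - ln (wprob P (block x 0 k)) <= C * k.+1%:R.
Proof.
have [d d0 dP] := @finite_positive_lower_bound R (rs.-tuple A * A)%type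
  (fun sb => tprob P sb.1 sb.2).
exists (`|ln (wprob P (block x 0 rs))| + `|ln d|) => k rk.
have := @ln_wprob rs k; rewrite leqnn rk => -> //.
have : \sum_(rs <= i < k) (- `|ln d|) <=
       \sum_(rs <= i < k) ln (trans rs (tprob P) (ctx x rs i) (x i)).
  rewrite big_nat [leRHS]big_nat; apply: ler_sum => i /andP[ri _].
  have tp : 0 < trans rs (tprob P) (ctx x rs i) (x i) by rewrite trans_pos ?leqnn.
  apply: (@le_trans _ _ (ln d)); first by rewrite lerNl -normrN ler_norm.
  rewrite ler_ln ?posrE//.
  have -> : trans rs (tprob P) (ctx x rs i) (x i) = tprob P (ctx x rs i) (x i).
    by rewrite /trans /suffix_of size_tuple subnn drop0.
  apply: (dP (ctx x rs i, x i)) => /=.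
  by move: tp; rewrite /trans /suffix_of size_tuple subnn drop0.
rewrite sumrN big_const_nat iter_addr_0 -mulr_natl => h.
have h1 : - ln (wprob P (block x 0 rs)) <= `|ln (wprob P (block x 0 rs))|.
  by rewrite -normrN ler_norm.
have h2 : (k - rs)%:R * `|ln d| <= k.+1%:R * `|ln d|.
  by rewrite ler_wpM2r// ler_nat; lia.
have h3 : `|ln (wprob P (block x 0 rs))| <= k.+1%:R * `|ln (wprob P (block x 0 rs))|.
  by rewrite ler_peMl// ler1n.
lra.
Qed.

(** A law of large numbers for transitions, with error relative to n and not to the number of
    visits. *)
Definition typical := forall e : R, 0 < e -> \forall n \near \oo,
  forall (s : rs.-tuple A) b,
  `|moves R (ctx x rs) x rs n s b - visits R (ctx x rs) rs n s * trans rs (tprob P) s b|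
    <= e * n%:R.

(** A single chi-square term is o(n), and its denominator is at most n; hence M^2 is o(n^2). *)
Lemma typical_of_chi2 (C : R) :
  (\forall n \near \oo, forall a, chi2 rs (tprob P) x rs n a <=
     (#|A| ^ rs)%:R * (192 * ln (ln n%:R) + C)) -> typical.
Proof.
move=> H e e0.
have D0 : 0 <= (#|A| ^ rs)%:R :> R by [].
have := @loglog_sublinear R ((#|A| ^ rs)%:R * 192) ((#|A| ^ rs)%:R * C) (e ^+ 2)
  (mulr_ge0 D0 (ler0n _ _)) (exprn_gt0 _ e0).
apply: filterS2 H => n H1 H2 s b.
have m0 := moves_ge0 R (ctx x rs) x rs n s b.
have mv := moves_le_visits R (ctx x rs) x rs n s b.
have vn := visits_le R (ctx x rs) rs n s.
have v0 := visits_ge0 R (ctx x rs) rs n s.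
have mpos : 0 < moves R (ctx x rs) x rs n s b -> 0 < trans rs (tprob P) s b.
  by move=> /moves_gt0[i [/andP[ri _] <- <-]]; rewrite trans_pos ?leqnn.
have := H1 b; rewrite /chi2 (bigD1 s)//=.
have : 0 <= \sum_(t | t != s) (moves R (ctx x rs) x rs n t b -
     visits R (ctx x rs) rs n t * trans rs (tprob P) t b) ^+ 2 /
    (visits R (ctx x rs) rs n t * trans rs (tprob P) t b).
  apply: sumr_ge0 => t _; rewrite divr_ge0 ?sqr_ge0// mulr_ge0 ?visits_ge0//.
  by case/andP: (tprob01 P (suffix_of rs t) b).
have /andP[p0 p1] : 0 <= trans rs (tprob P) s b <= 1 by exact: tprob01.
move: (moves _ _ _ _ _ s b) (visits _ _ _ _ s) (trans _ _ s b) p0 p1 m0 mv vn v0 mpos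
  => m v p p0 p1 m0 mv vn v0 mpos.
move: (\sum_(_ | _) _) => S S0 h.
(* Here the quotient is 0 by convention and carries no information, but an unvisited context or an
   impossible letter has no moves. *)
have [vp0|vpn] := eqVneq (v * p) 0.
  rewrite vp0 subr0; suff -> : m = 0 by rewrite normr0 mulr_ge0// ltW.
  apply/eqP; rewrite eq_le m0 andbT; move/eqP: vp0; rewrite mulf_eq0 => /orP[/eqP <-//|/eqP pe].
  by rewrite leNgt; apply/negP => /mpos; rewrite pe ltxx.
have vp : 0 < v * p by rewrite lt_def vpn mulr_ge0.
have vpn' : v * p <= n%:R.
  apply: le_trans (_ : v <= _); first by rewrite ler_piMr.
  by apply: (le_trans vn); rewrite ler_nat leq_subr.
have sq : (m - v * p) ^+ 2 <= (e * n%:R) ^+ 2.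
  have : (m - v * p) ^+ 2 / (v * p) <= e ^+ 2 * n%:R.
    apply: le_trans H2; apply: le_trans (le_trans _ h) _; first by rewrite lerDl.
    by rewrite le_eqVlt; apply/orP; left; apply/eqP; ring.
  rewrite ler_pdivrMr// => /le_trans; apply.
  by rewrite exprMn [n%:R ^+ 2]expr2 mulrA ler_wpM2l// mulr_ge0// sqr_ge0.
rewrite -(@ler_pXn2r _ 2) ?nnegrE ?mulr_ge0 ?(ltW e0)//.
by rewrite real_normK ?num_real.
Qed.

(* Up to o(n), the path visits t at least as often as a fixed fraction of its
   visits to s. *)
Definition frequents (s t : rs.-tuple A) := exists2 c : R, 0 < c &
  forall e : R, 0 < e -> \forall n \near \oo,
    c * visits R (ctx x rs) rs n s <= visits R (ctx x rs) rs n t + e * n%:R.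

Lemma frequents_refl s : frequents s s.
Proof.
exists 1 => // e e0; apply: nearW => n.
by rewrite mul1r lerDl mulr_ge0// ltW.
Qed.

Lemma frequents_trans s t u : frequents s t -> frequents t u -> frequents s u.
Proof.
move=> [c c0 st] [d d0 tu]; exists (d * c); first exact: mulr_gt0.
move=> e e0.
have e1 : 0 < e / (2 * d) by rewrite divr_gt0// mulr_gt0.
have e2 : 0 < e / 2 by rewrite divr_gt0.
apply: filterS2 (st _ e1) (tu _ e2) => n h1 h2.
rewrite -mulrA; apply: le_trans (ler_wpM2l (ltW d0) h1) _.
rewrite mulrDr (_ : d * (e / (2 * d) * n%:R) = e / 2 * n%:R); last by field; lra.
by lra.
Qed.

(** Each such move leads to a visit to t one step later; the last may fall at time n, outside the
    count, hence the 1. *)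
Lemma moves_le_next n (s t : rs.-tuple A) b : val t = suffix_of rs (rcons s b) ->
  moves R (ctx x rs) x rs n s b <= visits R (ctx x rs) rs n t + 1.
Proof.
move=> tE; apply: (@le_trans _ _ (\sum_(rs <= i < n) (ctx x rs i.+1 == t)%:R)).
  rewrite /moves big_nat [leRHS]big_nat; apply: ler_sum => i /andP[ri _].
  case: eqP => //= si; case: eqP => //= xi.
  suff -> : ctx x rs i.+1 = t by rewrite eqxx.
  apply: val_inj; rewrite tE -xi -si !val_ctx ?leqW// -block_rcons ?leq_subr//.
  by rewrite suffix_of_block//; lia.
have [nr|rn] := leqP n rs; first by rewrite big_geq// addr_ge0 ?visits_ge0.
have -> : \sum_(rs <= i < n) (ctx x rs i.+1 == t)%:R =
          \sum_(rs.+1 <= i < n.+1) (ctx x rs i == t)%:R :> R by rewrite big_add1.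
rewrite big_nat_recr//= lerD//; last by case: (_ == _).
rewrite /visits [leRHS]big_ltn// lerDr ler0n//.
Qed.

(** The fraction is the transition probability: on a typical path it gives the moves from s by b up
    to o(n), and each of them leads to t. *)
Lemma frequents_step (s t : rs.-tuple A) b : typical ->
  0 < trans rs (tprob P) s b -> val t = suffix_of rs (rcons s b) -> frequents s t.
Proof.
move=> typ p0 tE; exists (trans rs (tprob P) s b) => // e e0.
have e2 : 0 < e / 2 by rewrite divr_gt0.
near=> n.
have n2 : 2 / e <= n%:R by near: n; exact: nbhs_infty_ger.
have := moves_le_next n tE.
have : `|moves R (ctx x rs) x rs n s b - visits R (ctx x rs) rs n s * trans rs (tprob P) s b|
    <= e / 2 * n%:R by move: s t b p0 tE; near: n; exact: filterS (typ _ e2).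
rewrite ler_norml => /andP[h _] h'.
have : 2 <= e * n%:R by move: n2; rewrite ler_pdivrMr// mulrC.
lra.
Unshelve. all: by end_near.
Qed.

End OnePath.

(** The auxiliary path y leads from s to t through possible transitions; these are followed one by
    one for the visits of x. *)
Lemma frequents_irreducible x (s t : rs.-tuple A) : irreducible P rs -> typical x ->
  0 < wprob P s -> 0 < wprob P t -> frequents x s t.
Proof.
move=> irr typ s0 t0.
have [y [k [ys yt ypos]]] := irreducible_path statP irr (size_tuple s) (size_tuple t) s0 t0.
have -> : s = ctx y rs rs by apply: val_inj; rewrite val_ctx// subnn ys.
have -> : t = ctx y rs (rs + k) by apply: val_inj; rewrite val_ctx ?leq_addr// addnC addnK yt.
elim: k {yt t t0} => [|k IH]; first by rewrite addn0; exact: frequents_refl.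
apply: (frequents_trans IH); apply: (@frequents_step x _ _ (y (rs + k)%N) typ).
  by apply: trans_pos => //; rewrite leqnn leq_addr.
rewrite !val_ctx ?leq_addr// addnS -block_rcons ?leq_subr// suffix_of_block//; lia.
Qed.

Lemma visits_linear x (t : rs.-tuple A) : irreducible P rs ->
  (forall n, 0 < wprob P (block x 0 n)) -> typical x -> 0 < wprob P t ->
  exists2 c : R, 0 < c & \forall n \near \oo, c * n%:R <= visits R (ctx x rs) rs n t.
Proof.
move=> irr xpos typ t0.
have ch (s : rs.-tuple A) : exists c : R, 0 < c /\ (0 < wprob P s ->
  forall e : R, 0 < e -> \forall n \near \oo,
    c * visits R (ctx x rs) rs n s <= visits R (ctx x rs) rs n t + e * n%:R).
  have [s0|s0] := ltP 0 (wprob P s); last by exists 1; split=> //; rewrite ltNge s0.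
  by have [c c0 h] := frequents_irreducible irr typ s0 t0; exists c.
have [c cP] := fin_all_exists ch.
have [d d0 dc] := finite_positive_lower_bound c.
pose S : R := #|{: rs.-tuple A}|%:R.
have S0 : 0 < S by rewrite ltr0n; apply/card_gt0P; exists t.
(* With S contexts, d n / 2 <= S (N + e n) for the number N of visits to t. This e turns S e n into
   d n / 4 and leaves N >= e n. *)
pose e := d / (4 * S).
have e0 : 0 < e by rewrite divr_gt0// mulr_gt0.
exists e => //.
have all_s : \forall n \near \oo, forall s : rs.-tuple A, 0 < wprob P s ->
    c s * visits R (ctx x rs) rs n s <= visits R (ctx x rs) rs n t + e * n%:R.
  apply: filter_forall => s; have [s0|s0] := boolP (0 < wprob P s).
    by apply: filterS ((cP s).2 s0 _ e0).
  by apply: nearW.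
near=> n.
have n2 : (2 * rs)%:R <= n%:R :> R by near: n; exact: nbhs_infty_ger.
have H : forall s : rs.-tuple A, 0 < wprob P s ->
    c s * visits R (ctx x rs) rs n s <= visits R (ctx x rs) rs n t + e * n%:R.
  by near: n.
have : d * (n - rs)%:R <= S * (visits R (ctx x rs) rs n t + e * n%:R).
  rewrite -(sum_visits R (ctx x rs)) mulr_sumr mulr_natl -sumr_const.
  apply: ler_sum => s _; have [s0|] := ltP 0 (wprob P s).
    apply: le_trans (H s s0); rewrite ler_wpM2r ?visits_ge0//.
    by apply: dc; case: (cP s).
  move=> s0; have -> : visits R (ctx x rs) rs n s = 0.
    apply/eqP; rewrite eq_le visits_ge0 andbT leNgt; apply/negP.
    by move=> /(visits_pos xpos (leqnn _)); rewrite ltNge s0.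
  by rewrite mulr0 addr_ge0 ?visits_ge0// mulr_ge0// ltW.
have nr : n%:R / 2 <= (n - rs)%:R :> R.
  move: n2; rewrite ler_nat => n2.
  rewrite natrB; last by lia.
  by move: n2; rewrite -(ler_nat R) natrM; lra.
move=> h.
have : d * (n%:R / 2) <= S * (visits R (ctx x rs) rs n t + e * n%:R).
  by apply: le_trans h; rewrite ler_wpM2l// ltW.
rewrite mulrDr (_ : S * (e * n%:R) = d * n%:R / 4); last by rewrite /e; field; lra.
move=> h'; have : d * n%:R / 4 <= S * visits R (ctx x rs) rs n t by lra.
rewrite -ler_pdivrMl//; apply: le_trans.
by rewrite le_eqVlt; apply/orP; left; apply/eqP; rewrite /e; field; lra.
Unshelve. all: by end_near.
Qed.

End MarkovPath.

(** * Consistency *)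

Section Asymptotics.
Variable R : realType.

Lemma near_ln_ge (M : R) : \forall n \near \oo, M <= ln (n%:R : R).
Proof.
near=> n; have h : expR M <= n%:R by near: n; exact: nbhs_infty_ger.
by rewrite -(expRK M) ler_ln ?posrE ?expR_gt0// (lt_le_trans (expR_gt0 M)).
Unshelve. all: by end_near.
Qed.

Lemma near_lnln_ge (M : R) : \forall n \near \oo, M <= ln (ln (n%:R : R)).
Proof.
apply: filterS (near_ln_ge (expR M)) => n h.
by rewrite -(expRK M) ler_ln ?posrE ?expR_gt0// (lt_le_trans (expR_gt0 M)).
Qed.

Lemma near_ge_of_limn_einf (f : nat -> R) (c C : R) : c < C ->
  (C%:E <= limn_einf (fun n => (f n)%:E))%E -> \forall n \near \oo, c <= f n.
Proof.
move=> cC; rewrite limn_einf_lim (cvg_lim _ (@cvg_einfs_sup _ _))// => h.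
have [k hk] : exists k, (c%:E <= einfs (fun n => (f n)%:E) k)%E.
  apply: contrapT => /forallNP ne; move: cC; rewrite -lte_fin ltNge => /negP; apply.
  apply: (le_trans h); apply: ge_ereal_sup => _ [k _ <-].
  by apply: ltW; rewrite ltNge; apply/negP/ne.
exists k => // n kn; rewrite -lee_fin; apply: (le_trans hk).
by apply: ereal_inf_lbound; exists n.
Qed.

(** Here a = |A|, D and E are |A| to the true and to the larger order, and l = ln ln n. As C <= a l
    / 2, the gain per unit of E is below 200 a l <= f l / 2, so half of the larger penalty remains,
    and this is at least D f l. *)
Lemma penalty_gap (a D E l C f : R) : 2 <= a -> 2 * D <= E -> 0 < E ->
  1 <= l -> `|C| <= l -> 400 * a <= f ->
  E * (192 * a * l + C) - E * f * l < - (D * f * l).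
Proof.
move=> a2 DE E0 l1 Cl af.
have fl : 400 * a * l <= f * l by rewrite ler_wpM2r//; lra.
have al : 2 * l <= a * l by rewrite ler_wpM2r//; lra.
have gap : 192 * a * l + C < f * l / 2 by have := ler_norm C; lra.
have : E * (192 * a * l + C) < E * (f * l / 2) by rewrite ltr_pM2l.
have : D * (f * l) <= E / 2 * (f * l) by rewrite ler_wpM2r//; lra.
by rewrite -!mulrA; lra.
Qed.

(** No single z is close to two separated numbers; z will be the value that an order r kernel
    assigns to two different contexts. *)
Lemma two_point_sq (y y' z d : R) : 0 <= d -> d / 2 <= `|y - y'| ->
  d ^+ 2 / 8 <= (y - z) ^+ 2 + (y' - z) ^+ 2.
Proof.
move=> d0 dy.
have : (d / 2) ^+ 2 <= (y - y') ^+ 2.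
  by rewrite -[leRHS]real_normK ?num_real// ler_pXn2r// nnegrE// divr_ge0.
have := sqr_ge0 (y + y' - 2 * z); rewrite !expr2; lra.
Qed.

Lemma dist_far (p p' y y' d : R) : d <= `|p - p'| ->
  `|y - p| <= d / 4 -> `|y' - p'| <= d / 4 -> d / 2 <= `|y - y'|.
Proof.
move=> dp; have := ler_normB (y - y') ((y - p) - (y' - p')).
have -> : (y - y') - ((y - p) - (y' - p')) = p - p' by ring.
have := ler_normB (y - p) (y' - p'); lra.
Qed.

End Asymptotics.

Section MaxLogLikelihood.
Variables (R : realType) (A : finType) (a0 : A).
Implicit Type x : Omega a0.

Lemma wprob_block (P : probability (Omega a0) R) x n :
  P (block_event a0 0 n (block x 0 n)) = (wprob P (block x 0 n))%:E.
Proof.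
by rewrite /wprob size_block subn0 fineK// fin_num_measure//; exact: measurable_block_event.
Qed.

Lemma max_log_likelihood_le x n r (B : R) :
  (forall P : probability (Omega a0) R, Theta R a0 r P -> 0 < wprob P (block x 0 n) ->
     ln (wprob P (block x 0 n)) <= B) ->
  (max_log_likelihood R x n r <= B%:E)%E.
Proof.
move=> H; apply: ge_ereal_sup => _ [P ThP <-]; rewrite wprob_block.
have [p0|p0] := ltP 0 (wprob P (block x 0 n)); first by rewrite lne_EFin// lee_fin H.
by rewrite le0_lneNy ?leNye// lee_fin.
Qed.

Lemma max_log_likelihood_ge x n r (P : probability (Omega a0) R) :
  Theta R a0 r P -> 0 < wprob P (block x 0 n) ->
  ((ln (wprob P (block x 0 n)))%:E <= max_log_likelihood R x n r)%E.
Proof.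
move=> ThP p0; apply: ereal_sup_ubound; exists P => //.
by rewrite wprob_block lne_EFin.
Qed.

End MaxLogLikelihood.

Section Consistency.
Variables (R : realType) (A : finType) (a0 : A) (P : probability (Omega a0) R).
Variables (rs : nat).
Hypothesis A1 : (1 < #|A|)%N.
Hypothesis statP : stationary P.
Hypothesis ordP : markov_order P rs.
Hypothesis irrP : irreducible P rs.
Variable (x : Omega a0).
Hypothesis xpos : forall n, 0 < wprob P (block x 0 n).
Variable K : R.
Hypothesis K0 : 0 < K.
Hypothesis xK : bets_bound rs (tprob P) x K.

Let ThP : Theta R a0 rs P. Proof. by case: ordP. Qed.

Lemma path_chi2 : exists2 C, 0 <= C & forall k n a, (rs <= k)%N -> 1 <= ln n%:R :> R ->
  chi2 rs (tprob P) x k n a <= (#|A| ^ k)%:R * (192 * ln (ln n%:R) + C).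
Proof.
have [d d0 dP] := @finite_positive_lower_bound R (rs.-tuple A * A)%type
  (fun sb => tprob P sb.1 sb.2).
apply: (@chi2_loglog R A a0 rs (tprob P) x (@tprob01 _ _ _ _) K d A1 K0 xK d0).
move=> k s a rk.
have ss : size (suffix_of rs s) == rs by rewrite /suffix_of size_drop size_tuple subKn.
exact: (dP (Tuple ss, a)).
Qed.

(** This is [competitor_le] at k = r without the squared loss. The sum over letters gives the extra
    factor |A|, and the initial term, linear in r, is absorbed by |A|^r. *)
Lemma overfit_le : exists C : R, \forall n \near \oo,
  forall r (P' : probability (Omega a0) R), (rs <= r <= n)%N -> Theta R a0 r P' ->
    0 < wprob P' (block x 0 n) ->
    ln (wprob P' (block x 0 n)) <= ln (wprob P (block x 0 n)) +
      (#|A| ^ r)%:R * (192 * #|A|%:R * ln (ln n%:R) + C).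
Proof.
have [C C0 hC] := path_chi2.
have [B hB] := wprob_lower statP ThP xpos.
exists (#|A|%:R * C + `|B|).
apply: filterS (near_ln_ge (1 : R)) => n n1 r P' /andP[rr rn] ThP' P'x.
have [Q hQ] := competitor_le statP ThP xpos ThP' rr (leqnn r).
apply: (le_trans (hQ n rn P'x)).
set T := (\sum_(s : r.-tuple A) _) / 4.
have T0 : 0 <= T.
  rewrite divr_ge0//; apply: sumr_ge0 => s _; rewrite mulr_ge0 ?visits_ge0//.
  by apply: sumr_ge0 => b _; exact: sqr_ge0.
have S1 : \sum_b chi2 rs (tprob P) x r n b <=
    #|A|%:R * ((#|A| ^ r)%:R * (192 * ln (ln n%:R) + C)).
  rewrite mulr_natl -sumr_const; apply: ler_sum => b _; exact: hC.
have B1 : - ln (wprob P (block x 0 r)) <= `|B| * (#|A| ^ r)%:R.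
  apply: (le_trans (hB r rr)); apply: (@le_trans _ _ (`|B| * r.+1%:R)).
    by rewrite ler_wpM2r// ler_norm.
  by rewrite ler_wpM2l// ler_nat ltn_expl.
have -> : (#|A| ^ r)%:R * (192 * #|A|%:R * ln (ln n%:R) + (#|A|%:R * C + `|B|)) =
   #|A|%:R * ((#|A| ^ r)%:R * (192 * ln (ln n%:R) + C)) + `|B| * (#|A| ^ r)%:R by ring.
lra.
Qed.

Lemma underfit_le r : (r < rs)%N -> exists2 c : R, 0 < c & \forall n \near \oo,
  forall (P' : probability (Omega a0) R), Theta R a0 r P' ->
    0 < wprob P' (block x 0 n) ->
    ln (wprob P' (block x 0 n)) <= ln (wprob P (block x 0 n)) - c * n%:R.
Proof.
move=> rrs; have [C C0 hC] := path_chi2.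
have typ : typical P rs x.
  apply: (typical_of_chi2 statP xpos (C := C)).
  by apply: filterS (near_ln_ge (1 : R)) => n n1 a; exact: hC.
have [s [s' [a [[sr s'r] ss' s0 s'0 ne]]]] := order_witness statP ordP rrs.
pose t : rs.-tuple A := Tuple (introT eqP sr).
pose t' : rs.-tuple A := Tuple (introT eqP s'r).
have tt' : t' != t by apply: contra_neq ne => /(congr1 val)/= ->.
pose d := `|tprob P s a - tprob P s' a|.
have d0 : 0 < d by rewrite normr_gt0 subr_eq0.
have [c1 c10 h1] := visits_linear statP irrP xpos typ (s0 : 0 < wprob P t).
have [c2 c20 h2] := visits_linear statP irrP xpos typ (s'0 : 0 < wprob P t').
pose c := Num.min c1 c2.
have c0 : 0 < c by rewrite lt_min c10.
have cc1 : c <= c1 by rewrite ge_min lexx.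
have cc2 : c <= c2 by rewrite ge_min lexx orbT.
(* The squared loss will be at least 2 c' n: one half absorbs the chi-square and initial terms, the
   other is the claimed loss. *)
pose c' := c * d ^+ 2 / 64.
have c'0 : 0 < c' by rewrite divr_gt0// mulr_gt0// exprn_gt0.
exists c' => //.
(* Divided by at least c n visits, this error leaves the empirical frequencies within d / 4 of the
   transition probabilities. *)
have e0 : 0 < c * d / 4 by rewrite divr_gt0// mulr_gt0.
have te := typ _ e0.
have small := @loglog_sublinear R (#|A|%:R * (#|A| ^ rs)%:R * 192)
  (#|A|%:R * (#|A| ^ rs)%:R * C - ln (wprob P (block x 0 rs))) c'
  (mulr_ge0 (mulr_ge0 (ler0n _ _) (ler0n _ _)) (ler0n _ _)) c'0.
near=> n => P' ThP' P'x.
have rn : (rs <= n)%N by near: n; exact: nbhs_infty_ge.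
have n0 : 0 < n%:R :> R.
  by rewrite ltr0n; near: n; exact: nbhs_infty_gt.
have n1 : 1 <= ln n%:R :> R by near: n; exact: near_ln_ge.
have v1 : c1 * n%:R <= visits R (ctx x rs) rs n t by near: n.
have v2 : c2 * n%:R <= visits R (ctx x rs) rs n t' by near: n.
have tn : forall (s : rs.-tuple A) b,
  `|moves R (ctx x rs) x rs n s b - visits R (ctx x rs) rs n s * trans rs (tprob P) s b|
    <= c * d / 4 * n%:R by near: n.
have sm : #|A|%:R * (#|A| ^ rs)%:R * 192 * ln (ln n%:R) +
  (#|A|%:R * (#|A| ^ rs)%:R * C - ln (wprob P (block x 0 rs))) <= c' * n%:R by near: n.
have [Q hQ] := competitor_le statP ThP xpos ThP' (leqnn rs) (ltnW rrs).
apply: (le_trans (hQ n rn P'x)).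
have S1 : \sum_b chi2 rs (tprob P) x rs n b <=
    #|A|%:R * ((#|A| ^ rs)%:R * (192 * ln (ln n%:R) + C)).
  rewrite mulr_natl -sumr_const; apply: ler_sum => b _; exact: hC.
pose u (s : rs.-tuple A) b := moves R (ctx x rs) x rs n s b / visits R (ctx x rs) rs n s.
pose F (s : rs.-tuple A) := visits R (ctx x rs) rs n s * \sum_b (u s b - Q (suffix_of r s) b) ^+ 2.
have F0 (w : rs.-tuple A) : 0 <= F w.
  by rewrite mulr_ge0 ?visits_ge0//; apply: sumr_ge0 => b _; exact: sqr_ge0.
have Fge (w : rs.-tuple A) : c * n%:R <= visits R (ctx x rs) rs n w ->
    c * n%:R * (u w a - Q (suffix_of r w) a) ^+ 2 <= F w.
  move=> vs; apply: ler_pM => //; rewrite ?sqr_ge0// ?mulr_ge0 ?(ltW c0)//.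
  by rewrite (bigD1 a)//= lerDl; apply: sumr_ge0 => b _; exact: sqr_ge0.
have cn : 0 < c * n%:R by rewrite mulr_gt0.
have cv1 : c * n%:R <= visits R (ctx x rs) rs n t by apply: le_trans v1; rewrite ler_wpM2r.
have cv2 : c * n%:R <= visits R (ctx x rs) rs n t' by apply: le_trans v2; rewrite ler_wpM2r.
have uclose (w : rs.-tuple A) : c * n%:R <= visits R (ctx x rs) rs n w ->
    `|u w a - trans rs (tprob P) w a| <= d / 4.
  move=> vs; have vp := lt_le_trans cn vs.
  have -> : u w a - trans rs (tprob P) w a = (moves R (ctx x rs) x rs n w a -
     visits R (ctx x rs) rs n w * trans rs (tprob P) w a) / visits R (ctx x rs) rs n w.
    by rewrite /u mulrBl [X in _ = _ - X]mulrAC divff ?mul1r// gt_eqF.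
  rewrite normrM normfV (gtr0_norm vp) ler_pdivrMr//; apply: (le_trans (tn w a)).
  rewrite (_ : c * d / 4 * n%:R = d / 4 * (c * n%:R)); last by ring.
  by rewrite ler_wpM2l// divr_ge0// ltW.
have trE (w : rs.-tuple A) : trans rs (tprob P) w a = tprob P w a.
  by rewrite /trans /suffix_of size_tuple subnn drop0.
have := uclose t cv1; have := uclose t' cv2; rewrite !trE /= => l2 l1.
have uu := dist_far (lexx d) l1 l2.
have sqs := two_point_sq (Q (suffix_of r s) a) (ltW d0) uu.
have FF : c * n%:R * (d ^+ 2 / 8) <= \sum_(s : rs.-tuple A) F s.
  rewrite (bigD1 t)//= (bigD1 t')//= addrA.
  apply: ler_wpDr; first exact: sumr_ge0.
  (* By [ss'] the competitor uses the same prediction at both contexts. *)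
  have f1 := Fge t cv1; have f2 := Fge t' cv2.
  rewrite /= -ss' in f2; apply: le_trans (lerD f1 f2).
  by rewrite -mulrDr ler_wpM2l// ltW.
have -> : \sum_(s1 : rs.-tuple A) visits R (ctx x rs) rs n s1 *
   \sum_b (moves R (ctx x rs) x rs n s1 b / visits R (ctx x rs) rs n s1
      - Q (suffix_of r s1) b) ^+ 2 = \sum_(s : rs.-tuple A) F s by [].
have E1 : c * n%:R * (d ^+ 2 / 8) = 8 * (c' * n%:R) by rewrite /c'; field.
have E2 : #|A|%:R * ((#|A| ^ rs)%:R * (192 * ln (ln n%:R) + C)) =
  #|A|%:R * (#|A| ^ rs)%:R * 192 * ln (ln n%:R) + #|A|%:R * (#|A| ^ rs)%:R * C by ring.
lra.
Unshelve. all: by end_near.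
Qed.

(** Each wrong order is excluded by a bound on its penalized likelihood that lies below the value of
    order [rs] attained by P itself. *)
Lemma estimator_cvg (pen : nat -> nat -> R) (kappa f : nat -> R)
    (rhat : nat -> Omega a0 -> nat) :
  (\forall n \near \oo,
     (forall r : nat, pen n r = #|A|%:R ^+ r * f n * ln (ln (n%:R : R))) /\
     kappa n <= ln (n%:R : R)) ->
  kappa n @[n --> \oo] --> +oo ->
  (\forall n \near \oo, 400 * #|A|%:R <= f n) ->
  f n * ln (ln (n%:R : R)) / n%:R @[n --> \oo] --> (0 : R) ->
  order_estimator pen kappa rhat ->
  rhat n x @[n --> \oo] --> rs.
Proof.
move=> penE kinf fC fsub est; apply: cvg_near_cst.
have [C over] := overfit_le.
have under : exists2 c : R, 0 < c & \forall n \near \oo, forall r, (r < rs)%N ->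
    forall (P' : probability (Omega a0) R), Theta R a0 r P' ->
    0 < wprob P' (block x 0 n) ->
    ln (wprob P' (block x 0 n)) <= ln (wprob P (block x 0 n)) - c * n%:R.
  have ch (r : 'I_rs) : exists c : R, 0 < c /\ \forall n \near \oo,
      forall (P' : probability (Omega a0) R), Theta R a0 r P' ->
      0 < wprob P' (block x 0 n) ->
      ln (wprob P' (block x 0 n)) <= ln (wprob P (block x 0 n)) - c * n%:R.
    by have [c c0 h] := underfit_le (ltn_ord r); exists c.
  have [c cP] := fin_all_exists ch.
  have [d d0 dc] := finite_positive_lower_bound c.
  exists d => //.
  have : \forall n \near \oo, forall r : 'I_rs,
      forall (P' : probability (Omega a0) R), Theta R a0 r P' ->
      0 < wprob P' (block x 0 n) ->
      ln (wprob P' (block x 0 n)) <= ln (wprob P (block x 0 n)) - c r * n%:R.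
    by apply: filter_forall => r; case: (cP r).
  apply: filterS => n h r rrs P' ThP' P'x.
  apply: (le_trans (h (Ordinal rrs) P' ThP' P'x)).
  by rewrite lerD2l lerN2 ler_wpM2r// dc//; case: (cP (Ordinal rrs)).
have [c c0 {}under] := under.
have D0 : 0 < #|A|%:R ^+ rs :> R by rewrite exprn_gt0// ltr0n ltnW.
(* Chosen so that the penalty of [rs] stays below the underfitting loss c n. *)
have eps0 : 0 < c / (2 * #|A|%:R ^+ rs) by rewrite divr_gt0// mulr_gt0.
have fs : \forall n \near \oo, `|f n * ln (ln (n%:R : R)) / n%:R| < c / (2 * #|A|%:R ^+ rs).
  by move/cvgr0Pnorm_lt: fsub; apply.
near=> n.
have n0 : 0 < n%:R :> R by rewrite ltr0n; near: n; exact: nbhs_infty_gt.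
have [pE kn] : (forall r : nat, pen n r = #|A|%:R ^+ r * f n * ln (ln (n%:R : R))) /\
     kappa n <= ln (n%:R : R) by near: n.
have ov : forall r (P' : probability (Omega a0) R), (rs <= r <= n)%N -> Theta R a0 r P' ->
    0 < wprob P' (block x 0 n) ->
    ln (wprob P' (block x 0 n)) <= ln (wprob P (block x 0 n)) +
      (#|A| ^ r)%:R * (192 * #|A|%:R * ln (ln n%:R) + C) by near: n.
have un : forall r, (r < rs)%N ->
    forall (P' : probability (Omega a0) R), Theta R a0 r P' ->
    0 < wprob P' (block x 0 n) ->
    ln (wprob P' (block x 0 n)) <= ln (wprob P (block x 0 n)) - c * n%:R by near: n.
have fn : 400 * #|A|%:R <= f n by near: n.
have fsn : `|f n * ln (ln (n%:R : R)) / n%:R| < c / (2 * #|A|%:R ^+ rs) by near: n.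
have krs : rs%:R < kappa n by near: n; move/cvgryPgt: kinf; apply.
have l1 : 1 <= ln (ln (n%:R : R)) by near: n; exact: near_lnln_ge.
have lC : `|C| <= ln (ln (n%:R : R)) by near: n; exact: near_lnln_ge.
have [[rk best] _] := est n x (le_lt_trans (ler0n _ _) krs).
set r := rhat n x in rk best *.
apply: contrapT => /eqP rne.
have A2 : 2 <= #|A|%:R :> R by rewrite ler_nat.
(* The cutoff gives r < ln n <= n, as [overfit_le] requires. *)
have rn : (r <= n)%N.
  rewrite -(ler_nat R); apply: ltW; apply: (lt_le_trans rk); apply: (le_trans kn).
  exact: ln_le_self.
have lower := max_log_likelihood_ge ThP (xpos n).
suff [B BML BL] : exists2 B, (max_log_likelihood R x n r <= B%:E)%E &
    B - pen n r < ln (wprob P (block x 0 n)) - pen n rs.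
  have := best rs krs; rewrite /penalized => h.
  have h1 : ((ln (wprob P (block x 0 n)))%:E - (pen n rs)%:E <= B%:E - (pen n r)%:E)%E.
    apply: le_trans (le_trans h _); first exact: leeB.
    exact: leeB.
  by move: h1; rewrite -!EFinB lee_fin leNgt BL.
move: (ln (ln n%:R)) l1 lC pE ov fsn => l l1 lC pE ov fsn.
rewrite !pE.
have A0 : 0 < #|A|%:R :> R by rewrite ltr0n ltnW.
have f0 : 0 < f n by apply: lt_le_trans fn; rewrite mulr_gt0 ?A0 ?ltr0n.
have fl0 : 0 < f n * l by rewrite mulr_gt0//; lra.
have [rlt|rgt|/eqP] := ltngtP r rs; last by rewrite (negbTE rne).
- exists (ln (wprob P (block x 0 n)) - c * n%:R).
    by apply: max_log_likelihood_le => P' ThP' P'x; exact: (un r rlt P' ThP' P'x).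
  have : #|A|%:R ^+ rs * (f n * l) < c * n%:R.
    have : f n * l < c / (2 * #|A|%:R ^+ rs) * n%:R.
      by rewrite -ltr_pdivrMr//; apply: le_lt_trans fsn; exact: ler_norm.
    rewrite mulrAC ltr_pdivlMr ?mulr_gt0// => h.
    apply: le_lt_trans h; rewrite mulrC ler_wpM2l ?(ltW fl0)// ler_peMl ?(ltW D0)//; lra.
  have : 0 < #|A|%:R ^+ r * (f n * l) by rewrite mulr_gt0// exprn_gt0.
  rewrite !mulrA; lra.
exists (ln (wprob P (block x 0 n)) + (#|A| ^ r)%:R * (192 * #|A|%:R * l + C)).
  apply: max_log_likelihood_le => P' ThP' P'x; apply: ov => //.
  by rewrite (ltnW rgt).
have Dr : 2 * #|A|%:R ^+ rs <= #|A|%:R ^+ r :> R.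
  rewrite -[X in _ <= _ ^+ X](subnK (ltnW rgt)) exprD ler_wpM2r ?(ltW D0)//.
  by apply: (le_trans A2); rewrite ler_eXnr ?subn_gt0// (le_trans _ A2)// ler1n.
have Ep : 0 < #|A|%:R ^+ r :> R by rewrite exprn_gt0.
have := penalty_gap A2 Dr Ep l1 lC fn.
by rewrite natrX -addrA ltrD2l.
Unshelve. all: by end_near.
Qed.

End Consistency.

(** * The one-letter alphabet *)

Section OneLetter.
Variables (R : realType) (A : finType) (a0 : A).
Hypothesis A1 : #|A| = 1%N.

Lemma one_letter_wprob (P : probability (Omega a0) R) w : wprob P w = 1.
Proof.
have [a aP] := fintype1 A1.
elim/last_ind: w => [|w b IH]; first exact: wprob_nil.
rewrite -IH -[RHS]sum_wprob_rcons (bigD1 b)//= big1 ?addr0// => c.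
by rewrite (aP b) (aP c) eqxx.
Qed.

Lemma one_letter_max_log_likelihood (P : probability (Omega a0) R) (x : Omega a0) n r :
  Theta R a0 r P -> max_log_likelihood R x n r = 0%E :> \bar R.
Proof.
move=> ThP; apply/eqP; rewrite eq_le; apply/andP; split.
  by apply: max_log_likelihood_le => P' _ _; rewrite one_letter_wprob ln1.
have := @max_log_likelihood_ge R A a0 x n r P ThP.
by rewrite one_letter_wprob ln1; apply.
Qed.

Lemma one_letter_Theta (P : probability (Omega a0) R) r :
  stationary P -> Theta R a0 r P.
Proof.
move=> statP; apply: (Theta_of_wprob statP (g := fun _ _ => 1)) => w b _.
by rewrite !one_letter_wprob mulr1.
Qed.

End OneLetter.

Theorem corollary2p4 (R : realType) (A : finType) (a0 : A) :
  exists C : R, 0 < C /\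
  forall (Pstar : probability (Omega a0) R) (rstar : nat),
    markov_order Pstar rstar -> stationary Pstar -> irreducible Pstar rstar ->
  exists alpha : R, 0 < alpha /\
  forall (pen : nat -> nat -> R) (kappa f : nat -> R),
    (\forall n \near \oo,
       (forall r : nat,
          pen n r = #|A|%:R ^+ r * f n * ln (ln (n%:R : R))) /\
       kappa n <= alpha * ln (n%:R : R)) ->
    nondecreasing_seq kappa ->
    kappa n @[n --> \oo] --> +oo ->
    (C%:E <= limn_einf (fun n => (f n)%:E))%E ->
    f n * ln (ln (n%:R : R)) / n%:R @[n --> \oo] --> (0 : R) ->
  forall rhat : nat -> Omega a0 -> nat,
    order_estimator pen kappa rhat ->
    {ae Pstar, forall x : Omega a0, rhat n x @[n --> \oo] --> rstar}.
Proof.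
have A0 : (0 < #|A|)%N by apply/card_gt0P; exists a0.
(* A liminf of at least 401 |A| makes f eventually at least 400 |A|, the constant in
   [penalty_gap]. *)
exists (401 * #|A|%:R); split; first by rewrite mulr_gt0 ?ltr0n.
(* With alpha = 1 every candidate order is below ln n. *)
move=> P rs ordP statP irrP; exists 1; split => // pen kappa f penE _ kinf finf fsub rhat est.
have {}penE : \forall n \near \oo,
     (forall r : nat, pen n r = #|A|%:R ^+ r * f n * ln (ln (n%:R : R))) /\
     kappa n <= ln (n%:R : R).
  by apply: filterS penE => n; rewrite mul1r.
(* Over one letter all likelihoods are 1 and all penalties agree, so 0 is a maximizer; the
   tie-breaking rule selects it, and it is the true order. *)
have [A1|A1] := leqP #|A| 1.
  have cA : #|A| = 1%N by apply/eqP; rewrite eqn_leq A1.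
  have rs0 : rs = 0%N.
    by apply/eqP; rewrite -leqn0; apply: ordP.2; exact: one_letter_Theta.
  apply: aeW => x; apply: cvg_near_cst; near=> n.
  have k0 : 0 < kappa n by near: n; move/cvgryPgt: kinf; apply.
  have [pE _] : (forall r : nat, pen n r = #|A|%:R ^+ r * f n * ln (ln (n%:R : R))) /\
     kappa n <= ln (n%:R : R) by near: n.
  apply/eqP; rewrite rs0 -leqn0; have [_] := est n x k0; apply => //; split=> // s _.
  by rewrite /penalized !(one_letter_max_log_likelihood cA (P := P)) ?pE ?cA ?expr1n//;
    exact: one_letter_Theta.
have fC : \forall n \near \oo, 400 * #|A|%:R <= f n.
  apply: near_ge_of_limn_einf finf; rewrite ltr_pM2r ?ltr0n// ltr_nat.
  by [].
have := bets_bounded (@tprob01 _ _ _ P) (fun w a => Theta_wprob statP a ordP.1).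
apply: filterS2 (wprob_pos_prefixes P) => x xpos [K K0 xK].
exact: (estimator_cvg A1 statP ordP irrP xpos K0 xK penE kinf fC fsub est).
Unshelve. all: by end_near.
Qed.
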